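(* Let $1<p<\infty$. Let $\omega$ be a real function analytic in a neighborhood of $[0,\infty)$, positive and non-increasing on $[0,\infty)$, such that $\lambda(x)=-1/\omega'(x^2)$ is a positive, increasing, smooth function on $[0,\infty)$. Suppose that $\liminf_{x\to\infty}S(x,\lambda)>0$ and that there is a constant $C>0$ with $-\omega'(r)\ge C\,\omega(r)$ for all sufficiently large $r$. If $f$ is an entire function with $D_p(\infty,f;\omega)<\infty$, then \[ \lim_{r\to\infty}r^3M_p^p(r,f)\,\omega(r^2)=0 . \]
   Context: For a positive increasing smooth function $\lambda$ and $x_0>0$, $S(x_0,\lambda)=\int_{x_0}^\infty\frac{\lambda(x_0)}{\lambda(x)}\left(\frac{x}{x_0}\right)^{x_0\lambda'(x_0)/\lambda(x_0)}dx$. For an entire function $f$, $M_p(r,f)=\left(\int_0^{2\pi}|f(re^{i\theta})|^p\,d\theta\right)^{1/p}$ and $D_p(\infty,f;\omega)=\left(-\int_{\mathbb{C}}|z|^2|f(z)|^p\,\omega'(|z|^2)\,dA(z)\right)^{1/p}$, where $dA$ is area measure. *)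

(* Defs.v *)
From Stdlib Require Import Reals.
From mathcomp Require Import all_boot all_algebra all_classical all_reals all_analysis.
From mathcomp Require Import Rstruct Rstruct_topology.

Definition area_integral (g : R * R -> R) : \bar R :=
  (\int[(@lebesgue_measure R) \x (@lebesgue_measure R)]_(z in setT) (g z)%:E)%E.

From Coquelicot Require Import Coquelicot.
Open Scope R_scope.

(* real power x^a for x >= 0 (with 0^a = 0, a > 0 in our uses) *)
Definition rpow (x a : R) : R := if Rle_dec x 0 then 0 else Rpower x a.

Definition entire (f : C -> C) : Prop :=
  forall z : C, @ex_derive C_AbsRing C_NormedModule f z.

Definition analytic_near_nonneg (w : R -> R) : Prop :=
  forall x0, 0 <= x0 -> exists (a : nat -> R) (d : R), 0 < d /\
    forall x, Rabs (x - x0) < d -> is_pseries a (x - x0) (w x).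

Definition lam_of (w : R -> R) (x : R) : R := - 1 / Derive w (x ^ 2).

(* S(x0, lambda) = int_{x0}^oo lambda(x0)/lambda(x) (x/x0)^{x0 lambda'(x0)/lambda(x0)} dx
   (improper integral of a nonnegative function, value in [0, +oo]) *)
Definition S_fun (x0 : R) (lam : R -> R) : Rbar :=
  Lim (fun b => RInt (fun x => lam x0 / lam x *
          rpow (x / x0) (x0 * Derive lam x0 / lam x0)) x0 b) p_infty.

Definition liminf_pinfty (g : R -> Rbar) : Rbar :=
  Rbar_lub (fun m => exists X : R, m = Rbar_glb (fun y => exists x, X <= x /\ y = g x)).

Definition Mp (p r : R) (f : C -> C) : R :=
  rpow (RInt (fun t => rpow (Cmod (f (r * cos t, r * sin t)%R)) p) 0 (2 * PI)) (1 / p).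

Definition Dp_pow (p : R) (f : C -> C) (w : R -> R) : \bar R :=
  area_integral (fun z => - (Cmod z ^ 2 * rpow (Cmod (f z)) p * Derive w (Cmod z ^ 2))).

(* Main.v *)
Require Import Defs.
From Stdlib Require Import Reals Lra Lia Classical.
From Coquelicot Require Import Coquelicot.
Open Scope R_scope.

(** Write [phi r] for the integral of [|f|^p] over the circle of radius [r], [h r = r^3 phi r] and
    [u = h / lam].  In polar coordinates the finiteness of [Dp_pow] says that [u] is integrable at
    infinity, and since [w (r^2) <= 1 / (C0 lam r)] it suffices to show that [u] tends to [0].

    By Hardy's convexity theorem [log h] is a convex function of [log r].  If [x0] maximises [u] on
    some [[a, x0]], then the logarithmic slope of [h] at [x0] is at least that of [lam], so convexity
    keeps [h] above [h x0 (x / x0)^(x0 lam'(x0) / lam x0)] for [x >= x0]; integrating against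
    [1 / lam] bounds [u x0 * S x0] by the tail of the integral of [u].  Start from a point [a] far out
    with [u a] small: on each [[a, x]] the maximum of [u] is either [u a] or controlled by such a tail.

    Hardy's theorem is used as a maximum principle for [r^beta phi r], for every real [beta].  It comes
    from the mean value property of [exp (beta w / p) f (exp w)], which follows from Goursat's lemma
    as [f] is only assumed to be differentiable at every point. *)

(** The convexity theorem is not stated with [log phi], because [phi] vanishes identically when [f]
    does; a maximum principle for [r^beta phi r] with every real [beta] carries the same information
    and makes sense at zeros. The weight [r^beta] is absorbed into the analytic function:
    [z^(beta/p)] is multivalued in the plane, but after [z = exp w] it becomes the entire function
    [exp (beta w / p)], and only its modulus, which depends on the real part of [w] alone, enters
    the mean. The area integral serves only as an upper bound for the integrals of [u]. Polar
    coordinates are therefore proved as an inequality, up to a factor 4, by one-variable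
    substitutions in iterated Riemann integrals over squares; Lebesgue measure enters once, to bound
    these square integrals by [Dp_pow]. *)

(** * Continuity in two variables, integrals with a parameter, Fubini *)

Definition cont2 (f : R -> R -> R) : Prop := forall x y, continuity_2d_pt f x y.

Lemma cont2_comp (f g h : R -> R -> R) :
  cont2 f -> cont2 g -> cont2 h -> cont2 (fun x y => f (g x y) (h x y)).
Proof.
  intros Hf Hg Hh x y eps.
  destruct (Hf (g x y) (h x y) eps) as [d Hd].
  destruct (Hg x y d) as [d1 Hd1]. destruct (Hh x y d) as [d2 Hd2].
  assert (Hm : 0 < Rmin d1 d2) by (apply Rmin_pos; apply cond_pos).
  exists (mkposreal _ Hm); simpl; intros u v Hu Hv.
  apply Hd.
  - apply Hd1; eapply Rlt_le_trans; eauto; apply Rmin_l.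
  - apply Hd2; eapply Rlt_le_trans; eauto; apply Rmin_r.
Qed.

Lemma cont2_comp1 (f : R -> R) (g : R -> R -> R) :
  (forall x y, continuous f (g x y)) -> cont2 g -> cont2 (fun x y => f (g x y)).
Proof.
  intros Hf Hg x y. apply continuity_1d_2d_pt_comp; [|apply Hg].
  apply continuity_pt_filterlim, Hf.
Qed.

Lemma cont2_fst (f : R -> R) : (forall x, continuous f x) -> cont2 (fun x _ => f x).
Proof.
  intros Hf. apply (cont2_comp1 f (fun x _ => x)); [intros x _; apply Hf|].
  intros x y; apply continuity_2d_pt_id1.
Qed.

Lemma cont2_snd (f : R -> R) : (forall x, continuous f x) -> cont2 (fun _ y => f y).
Proof.
  intros Hf. apply (cont2_comp1 f (fun _ y => y)); [intros _ x; apply Hf|].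
  intros x y; apply continuity_2d_pt_id2.
Qed.

Lemma cont2_mult (f g : R -> R -> R) : cont2 f -> cont2 g -> cont2 (fun x y => f x y * g x y).
Proof. intros Hf Hg x y. now apply continuity_2d_pt_mult. Qed.

Lemma cont2_plus (f g : R -> R -> R) : cont2 f -> cont2 g -> cont2 (fun x y => f x y + g x y).
Proof. intros Hf Hg x y. now apply continuity_2d_pt_plus. Qed.

Lemma cont2_ext (f g : R -> R -> R) : (forall x y, f x y = g x y) -> cont2 f -> cont2 g.
Proof. intros E Hf x y. now apply (continuity_2d_pt_ext f). Qed.

Lemma cont2_slice_r (f : R -> R -> R) x : cont2 f -> forall y, continuous (f x) y.
Proof.
  intros Hf y. apply continuity_pt_filterlim, continuity_pt_locally. intros eps.
  destruct (Hf x y eps) as [d Hd]. exists d. intros v Hv. apply Hd; [|exact Hv].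
  rewrite Rminus_diag, Rabs_R0. apply cond_pos.
Qed.

Lemma cont2_swap (f : R -> R -> R) : cont2 f -> cont2 (fun x y => f y x).
Proof.
  intros Hf. apply (cont2_comp f (fun _ y => y) (fun x _ => x)); auto;
  intros x y; [apply continuity_2d_pt_id2 | apply continuity_2d_pt_id1].
Qed.

Lemma cont2_slice_l (f : R -> R -> R) y : cont2 f -> forall x, continuous (fun x => f x y) x.
Proof. intros Hf. apply (cont2_slice_r (fun y x => f x y)). now apply cont2_swap. Qed.

Lemma continuous_ex_RInt (f : R -> R) a b : (forall x, continuous f x) -> ex_RInt f a b.
Proof. intros Hf. apply (@ex_RInt_continuous R_CompleteNormedModule). intros; apply Hf. Qed.

Lemma RInt_param_continuous (f : R -> R -> R) a b :
  cont2 f -> forall x, continuous (fun x => RInt (f x) a b) x.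
Proof.
  intros Hf x.
  assert (Hle : forall a b, a <= b -> continuous (fun x => RInt (f x) a b) x).
  { clear a b; intros a b Hab. apply continuity_pt_filterlim, continuity_pt_locally. intros eps.
    (* Uniform continuity over the segment gives one [d] for all [t]; the [+ 1] covers [a = b]. *)
    assert (He : 0 < eps / (b - a + 1)) by (apply Rdiv_lt_0_compat; [apply cond_pos | lra]).
    destruct (uniform_continuity_2d_1d' f a b x (fun t _ => Hf x t) (mkposreal _ He)) as [d Hd].
    exists d. intros v Hv. change (Rabs (v - x) < d) in Hv.
    assert (Hi : forall x, ex_RInt (f x) a b)
      by (intros; apply continuous_ex_RInt, cont2_slice_r, Hf).
    assert (E : RInt (f v) a b - RInt (f x) a b = RInt (fun t => f v t - f x t) a b).
    { symmetry. apply (@RInt_minus R_CompleteNormedModule); apply Hi. }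
    rewrite E. pose proof (cond_pos d) as Hdp. apply Rabs_def2 in Hv.
    apply Rle_lt_trans with ((b - a) * (eps / (b - a + 1))).
    - apply abs_RInt_le_const; auto.
      + apply (@ex_RInt_minus R_NormedModule); apply Hi.
      + intros t Ht. left. apply Hd; try lra. rewrite Rminus_diag, Rabs_R0. lra.
    - pose proof (cond_pos eps). apply Rmult_lt_reg_r with (b - a + 1); [lra|].
      replace ((b - a) * (eps / (b - a + 1)) * (b - a + 1)) with ((b - a) * eps) by (field; lra). nra. }
  destruct (Rle_dec a b) as [Hab | Hab]; [now apply Hle|].
  apply continuous_ext with (fun x => opp (RInt (f x) b a)).
  - intros y. apply opp_RInt_swap. apply continuous_ex_RInt, cont2_slice_r, Hf.
  - apply (@continuous_opp R_UniformSpace R_AbsRing R_NormedModule (fun x => RInt (f x) b a)). apply Hle; lra.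
Qed.

(** As functions of the endpoint [b], both sides vanish at [a] and have the same derivative, the
    right-hand one by differentiation under the integral sign. *)
Lemma RInt_fubini (f : R -> R -> R) a b c d : cont2 f ->
  RInt (fun x => RInt (fun y => f x y) c d) a b = RInt (fun y => RInt (fun x => f x y) a b) c d.
Proof.
  intros Hf.
  set (F := fun t => RInt (fun y => RInt (fun x => f x y) a t) c d).
  assert (Hder : forall y t, is_derive (fun t => RInt (fun x => f x y) a t) t (f t y)).
  { intros y t. apply (@is_derive_RInt R_CompleteNormedModule (fun x => f x y) _ a).
    - apply filter_forall. intros s. apply (@RInt_correct R_CompleteNormedModule), continuous_ex_RInt.
      now apply cont2_slice_l.
    - now apply cont2_slice_l. }
  assert (HF : forall t, is_derive F t (RInt (fun y => f t y) c d)).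
  { intros t.
    rewrite (RInt_ext (fun y => f t y) (fun y => Derive (fun t => RInt (fun x => f x y) a t) t)).
    2:{ intros y _. symmetry. apply is_derive_unique, Hder. }
    apply (is_derive_RInt_param (fun t y => RInt (fun x => f x y) a t)).
    - apply filter_forall. intros s y _. eexists; apply Hder.
    - intros y _. apply continuity_2d_pt_ext with f; [|apply Hf].
      intros u v. symmetry. apply is_derive_unique, Hder.
    - apply filter_forall. intros s. apply continuous_ex_RInt.
      apply (RInt_param_continuous (fun y x => f x y)). now apply cont2_swap. }
  assert (HI : is_RInt (fun x => RInt (fun y => f x y) c d) a b (minus (F b) (F a))).
  { apply (is_RInt_derive F).
    - intros; apply HF.
    - intros; now apply RInt_param_continuous. }
  rewrite (is_RInt_unique _ _ _ _ HI).
  assert (E : F a = 0).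
  { unfold F. rewrite (RInt_ext _ (fun _ => 0)).
    - rewrite RInt_const. apply Rmult_0_r.
    - intros. apply (@RInt_point R_CompleteNormedModule). }
  rewrite E. unfold minus, plus, opp; simpl. fold (F b). ring.
Qed.

Lemma RInt_periodic (f : R -> R) T a :
  (forall x, continuous f x) -> (forall x, f (x + T) = f x) ->
  RInt f a (a + T) = RInt f 0 T.
Proof.
  intros Hf Hper.
  assert (Hi : forall a b, ex_RInt f a b) by (intros; now apply continuous_ex_RInt).
  pose proof (RInt_Chasles f a 0 (a + T) (Hi _ _) (Hi _ _)) as E1.
  pose proof (RInt_Chasles f 0 T (a + T) (Hi _ _) (Hi _ _)) as E2.
  pose proof (opp_RInt_swap f 0 a (Hi _ _)) as E3.
  assert (E4 : RInt f T (a + T) = RInt f 0 a).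
  { pose proof (RInt_comp_lin f 1 T 0 a (Hi _ _)) as E.
    replace (1 * 0 + T) with T in E by ring. replace (1 * a + T) with (a + T) in E by ring.
    rewrite <- E. apply RInt_ext. intros x _. rewrite <- (Hper x).
    unfold scal; simpl; unfold mult; simpl. rewrite !Rmult_1_l. reflexivity. }
  unfold plus, opp in *; simpl in *. lra.
Qed.

(** * Goursat's lemma *)

(** Differentiability of [P] and [Q] at one point, the shared coefficient [b] expressing
    [dP/dy = dQ/dx] there. Nothing is said about continuity of the partial derivatives, hence the
    subdivision argument. *)
Definition closed_form_at (P Q : R -> R -> R) (x0 y0 : R) : Prop :=
  exists a b c, forall eps, 0 < eps -> exists d, 0 < d /\ forall x y,
    Rabs (x - x0) < d -> Rabs (y - y0) < d ->
    Rabs (P x y - (P x0 y0 + a * (x - x0) + b * (y - y0)))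
      <= eps * (Rabs (x - x0) + Rabs (y - y0)) /\
    Rabs (Q x y - (Q x0 y0 + b * (x - x0) + c * (y - y0)))
      <= eps * (Rabs (x - x0) + Rabs (y - y0)).

(** The integral of [P dx + Q dy] along the counterclockwise boundary of a rectangle. *)
Definition circulation (P Q : R -> R -> R) (x y l m : R) : R :=
  RInt (fun t => P t y) x (x + l) - RInt (fun t => P t (y + m)) x (x + l)
  + RInt (fun t => Q (x + l) t) y (y + m) - RInt (fun t => Q x t) y (y + m).

Section Goursat.
Variables P Q : R -> R -> R.
Hypothesis contP : cont2 P.
Hypothesis contQ : cont2 Q.

Let intP y a b : ex_RInt (fun t => P t y) a b.
Proof. now apply continuous_ex_RInt, cont2_slice_l. Qed.
Let intQ x a b : ex_RInt (fun t => Q x t) a b.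
Proof. now apply continuous_ex_RInt, cont2_slice_r. Qed.

Lemma circulation_quarter x y l m :
  circulation P Q x y l m =
  circulation P Q x y (l / 2) (m / 2) + circulation P Q (x + l / 2) y (l / 2) (m / 2)
  + circulation P Q x (y + m / 2) (l / 2) (m / 2)
  + circulation P Q (x + l / 2) (y + m / 2) (l / 2) (m / 2).
Proof.
  unfold circulation.
  replace (x + l / 2 + l / 2) with (x + l) by field.
  replace (y + m / 2 + m / 2) with (y + m) by field.
  pose proof (RInt_Chasles (fun t => P t y) x (x + l / 2) (x + l) (intP _ _ _) (intP _ _ _)).
  pose proof (RInt_Chasles (fun t => P t (y + m)) x (x + l / 2) (x + l) (intP _ _ _) (intP _ _ _)).
  pose proof (RInt_Chasles (fun t => Q x t) y (y + m / 2) (y + m) (intQ _ _ _) (intQ _ _ _)).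
  pose proof (RInt_Chasles (fun t => Q (x + l) t) y (y + m / 2) (y + m) (intQ _ _ _) (intQ _ _ _)).
  unfold plus in *; simpl in *. lra.
Qed.

(** One of the four quarters carries at least a quarter of the total. The choice is made in a [sig],
    not an existential, because [corner] iterates it by recursion. *)
Lemma circulation_quarter_bound x y l m :
  { q : R * R | (fst q = x \/ fst q = x + l / 2) /\ (snd q = y \/ snd q = y + m / 2) /\
    Rabs (circulation P Q x y l m) <= 4 * Rabs (circulation P Q (fst q) (snd q) (l / 2) (m / 2)) }.
Proof.
  pose proof (circulation_quarter x y l m) as E.
  set (A := Rabs (circulation P Q x y l m)).
  set (q1 := circulation P Q x y (l / 2) (m / 2)) in *.
  set (q2 := circulation P Q (x + l / 2) y (l / 2) (m / 2)) in *.
  set (q3 := circulation P Q x (y + m / 2) (l / 2) (m / 2)) in *.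
  set (q4 := circulation P Q (x + l / 2) (y + m / 2) (l / 2) (m / 2)) in *.
  destruct (Rle_dec A (4 * Rabs q1)); [exists (x, y); simpl; auto|].
  destruct (Rle_dec A (4 * Rabs q2)); [exists (x + l / 2, y); simpl; auto|].
  destruct (Rle_dec A (4 * Rabs q3)); [exists (x, y + m / 2); simpl; auto|].
  exists (x + l / 2, y + m / 2); simpl; repeat split; auto. fold q4.
  assert (A <= Rabs q1 + Rabs q2 + Rabs q3 + Rabs q4).
  { unfold A. rewrite E.
    eapply Rle_trans; [apply Rabs_triang|]. apply Rplus_le_compat_r.
    eapply Rle_trans; [apply Rabs_triang|]. apply Rplus_le_compat_r. apply Rabs_triang. }
  lra.
Qed.

Variables X Y L M : R.
Hypothesis Lpos : 0 <= L.
Hypothesis Mpos : 0 <= M.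

Fixpoint corner (n : nat) : R * R :=
  match n with
  | O => (X, Y)
  | S n => proj1_sig (circulation_quarter_bound (fst (corner n)) (snd (corner n)) (L / 2 ^ n) (M / 2 ^ n))
  end.

Lemma corner_step n :
  let q := corner n in let q' := corner (S n) in
  (fst q' = fst q \/ fst q' = fst q + L / 2 ^ S n) /\
  (snd q' = snd q \/ snd q' = snd q + M / 2 ^ S n) /\
  Rabs (circulation P Q (fst q) (snd q) (L / 2 ^ n) (M / 2 ^ n))
    <= 4 * Rabs (circulation P Q (fst q') (snd q') (L / 2 ^ S n) (M / 2 ^ S n)).
Proof.
  simpl corner. destruct circulation_quarter_bound as [q Hq]. simpl proj1_sig.
  assert (2 ^ n <> 0) by (apply pow_nonzero; lra).
  replace (L / 2 ^ S n) with (L / 2 ^ n / 2) by (simpl; field; auto).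
  replace (M / 2 ^ S n) with (M / 2 ^ n / 2) by (simpl; field; auto).
  exact Hq.
Qed.

Lemma corner_bound n :
  Rabs (circulation P Q X Y L M)
  <= 4 ^ n * Rabs (circulation P Q (fst (corner n)) (snd (corner n)) (L / 2 ^ n) (M / 2 ^ n)).
Proof.
  induction n as [|n IH].
  - simpl. rewrite !Rdiv_1_r. lra.
  - destruct (corner_step n) as (_ & _ & H). pose proof (pow_lt 4 n ltac:(lra)).
    eapply Rle_trans; [apply IH|].
    replace (4 ^ S n) with (4 ^ n * 4) by (simpl; ring). nra.
Qed.

(** Each interval [[u n, u n + l / 2 ^ n]] contains the next one, so every left end lies below every
    right end and the supremum of the left ends works. *)
Lemma nested_halving_limit (u : nat -> R) l : 0 <= l ->
  (forall n, u (S n) = u n \/ u (S n) = u n + l / 2 ^ S n) ->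
  exists z, forall n, u n <= z <= u n + l / 2 ^ n.
Proof.
  intros Hl Hu.
  assert (Hstep : forall n, u n <= u (S n) /\ u (S n) + l / 2 ^ S n <= u n + l / 2 ^ n).
  { intros n. pose proof (pow_lt 2 n ltac:(lra)).
    assert (l / 2 ^ n = l / 2 ^ S n + l / 2 ^ S n) by (simpl; field; lra).
    assert (0 <= l / 2 ^ S n) by (apply Rdiv_le_0_compat; [auto | apply pow_lt; lra]).
    destruct (Hu n); lra. }
  assert (Hmono : forall k n, u n <= u (n + k)%nat /\ u (n + k)%nat + l / 2 ^ (n + k) <= u n + l / 2 ^ n).
  { induction k as [|k IH]; intros n.
    - rewrite Nat.add_0_r; lra.
    - rewrite Nat.add_succ_r. specialize (IH n). specialize (Hstep (n + k)%nat). lra. }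
  assert (Hnn : forall n, 0 <= l / 2 ^ n) by (intros; apply Rdiv_le_0_compat; [auto | apply pow_lt; lra]).
  assert (Hall : forall m n, u m <= u n + l / 2 ^ n).
  { intros m n. destruct (Nat.le_gt_cases m n) as [H|H].
    - replace n with (m + (n - m))%nat by lia. pose proof (Hmono (n - m)%nat m).
      pose proof (Hnn (m + (n - m))%nat). lra.
    - replace m with (n + (m - n))%nat by lia. pose proof (Hmono (m - n)%nat n).
      pose proof (Hnn (n + (m - n))%nat). lra. }
  destruct (completeness (fun x => exists n, x = u n)) as [z [Hz1 Hz2]].
  - exists (u O + l / 2 ^ 0). intros x [n ->]. apply Hall.
  - exists (u O), O. reflexivity.
  - exists z. intros n. split.
    + apply Hz1. now exists n.
    + apply Hz2. intros x [m ->]. apply Hall.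
Qed.

(** The affine parts cancel: the horizontal sides contribute [- b m l] and the vertical ones
    [b l m]. The error is at most [2 eps] per unit length on each pair of opposite sides. *)
Lemma circulation_affine_bound x0 y0 a b c eps x y l m :
  0 <= l -> 0 <= m ->
  (forall s t, x <= s <= x + l -> y <= t <= y + m ->
    Rabs (P s t - (P x0 y0 + a * (s - x0) + b * (t - y0))) <= eps /\
    Rabs (Q s t - (Q x0 y0 + b * (s - x0) + c * (t - y0))) <= eps) ->
  Rabs (circulation P Q x y l m) <= 2 * (l + m) * eps.
Proof.
  intros Hl Hm H.
  assert (Hb : forall g, (forall t, continuous g t) -> forall u v k e, u <= v ->
     (forall t, u <= t <= v -> Rabs (g t - k) <= e) -> Rabs (RInt g u v - (v - u) * k) <= (v - u) * e).
  { intros g Hg u v k e Huv He.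
    assert (E : RInt g u v - (v - u) * k = RInt (fun t => g t - k) u v).
    { symmetry. transitivity (RInt g u v - RInt (fun _ => k) u v).
      - apply (@RInt_minus R_CompleteNormedModule); [now apply continuous_ex_RInt | apply ex_RInt_const].
      - f_equal. apply (@RInt_const R_CompleteNormedModule). }
    rewrite E. apply abs_RInt_le_const; auto.
    apply (@ex_RInt_minus R_NormedModule g); [now apply continuous_ex_RInt | apply ex_RInt_const]. }
  assert (HP : Rabs (RInt (fun t => P t y - P t (y + m)) x (x + l) - (x + l - x) * (- b * m)) <= (x + l - x) * (2 * eps)).
  { apply Hb; [|lra|].
    - intros t. apply (continuous_minus (V := R_NormedModule) (fun t => P t y) (fun t => P t (y + m)));
        now apply cont2_slice_l.
    - intros t Ht. destruct (H t y) as [H1 _]; [lra..|]. destruct (H t (y + m)) as [H2 _]; [lra..|].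
      revert H1 H2. unfold Rabs. repeat destruct Rcase_abs; lra. }
  assert (HQ : Rabs (RInt (fun t => Q (x + l) t - Q x t) y (y + m) - (y + m - y) * (b * l)) <= (y + m - y) * (2 * eps)).
  { apply Hb; [|lra|].
    - intros t. apply (continuous_minus (V := R_NormedModule) (fun t => Q (x + l) t) (fun t => Q x t));
        now apply cont2_slice_r.
    - intros t Ht. destruct (H x t) as [_ H1]; [lra..|]. destruct (H (x + l) t) as [_ H2]; [lra..|].
      revert H1 H2. unfold Rabs. repeat destruct Rcase_abs; lra. }
  assert (E1 : RInt (fun t => P t y - P t (y + m)) x (x + l) = RInt (fun t => P t y) x (x + l) - RInt (fun t => P t (y + m)) x (x + l))
    by (apply (@RInt_minus R_CompleteNormedModule); apply intP).
  assert (E2 : RInt (fun t => Q (x + l) t - Q x t) y (y + m) = RInt (fun t => Q (x + l) t) y (y + m) - RInt (fun t => Q x t) y (y + m))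
    by (apply (@RInt_minus R_CompleteNormedModule); apply intQ).
  rewrite E1 in HP. rewrite E2 in HQ. unfold circulation.
  revert HP HQ. unfold Rabs. repeat destruct Rcase_abs; lra.
Qed.

Theorem goursat : (forall x y, closed_form_at P Q x y) -> circulation P Q X Y L M = 0.
Proof.
  intros Hcl.
  destruct (nested_halving_limit (fun n => fst (corner n)) L Lpos) as [x0 Hx0];
    [intros n; apply corner_step|].
  destruct (nested_halving_limit (fun n => snd (corner n)) M Mpos) as [y0 Hy0];
    [intros n; apply corner_step|].
  destruct (Hcl x0 y0) as (a & b & c & Habc).
  (* Both the perimeter and the distance to the limit point shrink like [1 / 2 ^ n], which pays for
     the factor [4 ^ n] of [corner_bound]. *)
  assert (Hsmall : forall eps, 0 < eps -> Rabs (circulation P Q X Y L M) <= 2 * (L + M) * (L + M) * eps).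
  { intros eps Heps. destruct (Habc eps Heps) as (d & Hd & H).
    assert (HN : exists n, (L + M) / 2 ^ n < d).
    { destruct (pow_lt_1_zero (/ 2) ltac:(rewrite Rabs_pos_eq; lra) (d / (L + M + 1))) as [n Hn].
      { apply Rdiv_lt_0_compat; lra. }
      exists n. specialize (Hn n (le_n _)).
      assert (0 < 2 ^ n) by (apply pow_lt; lra).
      rewrite <- Rinv_pow_depr, Rabs_pos_eq in Hn; [|left; now apply Rinv_0_lt_compat | lra].
      apply Rmult_lt_compat_r with (r := L + M + 1) in Hn; [|lra].
      replace (d / (L + M + 1) * (L + M + 1)) with d in Hn by (field; lra).
      unfold Rdiv. assert (0 < / 2 ^ n) by now apply Rinv_0_lt_compat. nra. }
    destruct HN as [n Hn]. assert (H2 : 0 < 2 ^ n) by (apply pow_lt; lra).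
    assert (HL : 0 <= L / 2 ^ n) by now apply Rdiv_le_0_compat.
    assert (HM : 0 <= M / 2 ^ n) by now apply Rdiv_le_0_compat.
    assert (Hs : (L + M) / 2 ^ n = L / 2 ^ n + M / 2 ^ n) by (field; lra).
    specialize (Hx0 n). specialize (Hy0 n). simpl in Hx0, Hy0.
    assert (HC := circulation_affine_bound x0 y0 a b c (eps * ((L + M) / 2 ^ n))
      (fst (corner n)) (snd (corner n)) (L / 2 ^ n) (M / 2 ^ n) HL HM).
    assert (Rabs (circulation P Q (fst (corner n)) (snd (corner n)) (L / 2 ^ n) (M / 2 ^ n))
      <= 2 * (L / 2 ^ n + M / 2 ^ n) * (eps * ((L + M) / 2 ^ n))).
    { apply HC. intros s t Hs' Ht'.
      assert (A1 : Rabs (s - x0) <= L / 2 ^ n) by (apply Rabs_le; lra).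
      assert (A2 : Rabs (t - y0) <= M / 2 ^ n) by (apply Rabs_le; lra).
      destruct (H s t) as [B1 B2]; [lra..|].
      split; (eapply Rle_trans; [eassumption|]); apply Rmult_le_compat_l; lra. }
    eapply Rle_trans; [apply (corner_bound n)|].
    assert (E4 : 4 ^ n = 2 ^ n * 2 ^ n) by (rewrite <- Rpow_mult_distr; f_equal; ring).
    apply Rle_trans with (4 ^ n * (2 * (L / 2 ^ n + M / 2 ^ n) * (eps * ((L + M) / 2 ^ n)))).
    - apply Rmult_le_compat_l; [apply pow_le; lra | assumption].
    - rewrite E4. apply Req_le. field. lra. }
  destruct (Req_dec (circulation P Q X Y L M) 0) as [|Hne]; [assumption|exfalso].
  pose proof (Rabs_pos_lt _ Hne) as Hp.
  set (A := Rabs (circulation P Q X Y L M)) in *.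
  assert (Hsq : 0 <= (L + M) * (L + M)) by apply Rle_0_sqr.
  (* With this value the bound falls below [A / 2]; the [+ 1] covers [L + M = 0]. *)
  specialize (Hsmall (A / (4 * ((L + M) * (L + M)) + 1)) ltac:(apply Rdiv_lt_0_compat; lra)).
  assert (A * (4 * ((L + M) * (L + M)) + 1) <= 2 * (L + M) * (L + M) * A); [|nra].
  apply Rmult_le_compat_r with (r := 4 * ((L + M) * (L + M)) + 1) in Hsmall; [|lra].
  replace (2 * (L + M) * (L + M) * (A / (4 * ((L + M) * (L + M)) + 1)) * (4 * ((L + M) * (L + M)) + 1))
    with (2 * (L + M) * (L + M) * A) in Hsmall by (field; lra).
  exact Hsmall.
Qed.
End Goursat.

(** * The mean value property *)

Notation is_Cderive F z l :=
  (@is_derive C_AbsRing (AbsRing_NormedModule C_AbsRing) F z l).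

Lemma is_Cderive_eps (F : C -> C) (z l : C) :
  is_Cderive F z l <->
  forall eps, 0 < eps -> exists d, 0 < d /\ forall w : C, Cmod (w - z) < d ->
    Cmod (F w - F z - (w - z) * l) <= eps * Cmod (w - z).
Proof.
  split.
  - intros [_ H] eps Heps.
    destruct (H z (fun P HP => HP) (mkposreal eps Heps)) as [d Hd].
    exists d. split; [apply cond_pos|]. intros w Hw. exact (Hd w Hw).
  - intros H. split; [apply is_linear_scal_l|].
    intros x Hx. assert (E : x = z).
    { symmetry. apply (is_filter_lim_locally_unique (V := AbsRing_NormedModule C_AbsRing)). exact Hx. }
    subst x. intros eps. destruct (H eps (cond_pos eps)) as (d & Hd & H').
    exists (mkposreal d Hd). intros w Hw. exact (H' w Hw).
Qed.

Definition holomorphic (F : C -> C) : Prop := forall z, exists l, is_Cderive F z l.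

Lemma holomorphic_comp (F G : C -> C) :
  holomorphic F -> holomorphic G -> holomorphic (fun z => F (G z)).
Proof.
  intros HF HG z. destruct (HG z) as [l Hl]. destruct (HF (G z)) as [m Hm].
  exists (l * m)%C.
  now apply (@is_derive_comp C_AbsRing (AbsRing_NormedModule C_AbsRing) F G z).
Qed.

Lemma holomorphic_mult (F G : C -> C) :
  holomorphic F -> holomorphic G -> holomorphic (fun z => (F z * G z)%C).
Proof.
  intros HF HG z. destruct (HG z) as [l Hl]. destruct (HF z) as [m Hm].
  exists (m * G z + F z * l)%C.
  apply (@is_derive_mult C_AbsRing F G z); try assumption. apply Cmult_comm.
Qed.

Lemma holomorphic_affine (a b : C) : holomorphic (fun z => (a * z + b)%C).
Proof.
  intros z. exists a. apply is_Cderive_eps. intros eps Heps. exists 1. split; [lra|].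
  intros w _. replace (a * w + b - (a * z + b) - (w - z) * a)%C with (RtoC 0) by ring.
  rewrite Cmod_0. apply Rmult_le_pos; [lra | apply Cmod_ge_0].
Qed.

Definition Cexp (z : C) : C := (exp (fst z) * cos (snd z), exp (fst z) * sin (snd z)).

Lemma Cexp_plus (z w : C) : Cexp (z + w) = (Cexp z * Cexp w)%C.
Proof.
  unfold Cexp, Cmult; simpl. rewrite exp_plus, cos_plus, sin_plus.
  f_equal; ring.
Qed.

Lemma Cmod_Cexp z : Cmod (Cexp z) = exp (fst z).
Proof.
  unfold Cmod, Cexp; simpl.
  pose proof (sin2_cos2 (snd z)) as H. unfold Rsqr in H.
  replace (exp (fst z) * cos (snd z) * (exp (fst z) * cos (snd z) * 1)
    + exp (fst z) * sin (snd z) * (exp (fst z) * sin (snd z) * 1)) with (Rsqr (exp (fst z))).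
  - apply sqrt_Rsqr. left; apply exp_pos.
  - unfold Rsqr. transitivity (exp (fst z) * exp (fst z) * (sin (snd z) * sin (snd z) + cos (snd z) * cos (snd z))).
    + rewrite H; ring.
    + ring.
Qed.

Lemma Rabs_re_le (z : C) : Rabs (fst z) <= Cmod z.
Proof. eapply Rle_trans; [|apply Rmax_Cmod]. apply Rmax_l. Qed.

Lemma Rabs_im_le (z : C) : Rabs (snd z) <= Cmod z.
Proof. eapply Rle_trans; [|apply Rmax_Cmod]. apply Rmax_r. Qed.

Lemma Cmod_le_sum (z : C) : Cmod z <= Rabs (fst z) + Rabs (snd z).
Proof.
  unfold Cmod. apply Rsqr_incr_0_var.
  - rewrite Rsqr_sqrt by nra. unfold Rsqr.
    rewrite <- (pow2_abs (fst z)), <- (pow2_abs (snd z)).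
    pose proof (Rabs_pos (fst z)). pose proof (Rabs_pos (snd z)). nra.
  - pose proof (Rabs_pos (fst z)). pose proof (Rabs_pos (snd z)). lra.
Qed.

Lemma is_Cderive_Cexp_0 : is_Cderive Cexp (RtoC 0) (RtoC 1).
Proof.
  apply is_Cderive_eps. intros eps Heps.
  assert (D : forall (g : R -> R) l, is_derive g 0 l -> forall e, 0 < e -> exists d, 0 < d /\
     forall x, Rabs x < d -> Rabs (g x - g 0 - l * x) <= e * Rabs x).
  { intros g l Hg e He. destruct Hg as [_ Hg].
    destruct (Hg 0 (fun P HP => HP) (mkposreal e He)) as [d Hd].
    exists d. split; [apply cond_pos|]. intros x Hx. specialize (Hd x).
    unfold norm, minus, plus, opp, scal in Hd; simpl in Hd.
    unfold abs, mult in Hd; simpl in Hd.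
    replace (g x - g 0 - l * x) with (g x + - g 0 + - ((x + - 0) * l)) by ring.
    replace (Rabs x) with (Rabs (x + - 0)) by (f_equal; ring).
    apply Hd. unfold ball; simpl. unfold AbsRing_ball, abs, minus, plus, opp; simpl.
    replace (x + - 0) with x by ring. exact Hx. }
  (* The errors in the real and imaginary parts come out as [3 e m] and [5 e m], hence the 8. The
     condition [m < e] absorbs the quadratic term, and [e <= 1 / 8] gives the crude bounds by [2]
     and [2 m]. *)
  set (e := Rmin 1 eps / 8).
  assert (He : 0 < e) by (unfold e; apply Rdiv_lt_0_compat; [apply Rmin_pos; lra | lra]).
  assert (He1 : e <= 1 / 8) by (unfold e; pose proof (Rmin_l 1 eps); lra).
  assert (He2 : e <= eps / 8) by (unfold e; pose proof (Rmin_r 1 eps); lra).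
  destruct (D exp 1) with e as (d1 & Hd1 & H1); auto.
  { replace 1 with (exp 0) by apply exp_0. apply is_derive_exp. }
  destruct (D cos 0) with e as (d2 & Hd2 & H2); auto.
  { replace 0 with (- sin 0) at 2 by (rewrite sin_0; ring). apply is_derive_cos. }
  destruct (D sin 1) with e as (d3 & Hd3 & H3); auto.
  { replace 1 with (cos 0) by apply cos_0. apply is_derive_sin. }
  exists (Rmin (Rmin d1 d2) (Rmin d3 e)). split; [repeat apply Rmin_pos; auto|].
  intros w Hw. replace (w - 0)%C with w in * by ring.
  destruct w as [x y].
  assert (Hx := Rabs_re_le (x, y)). assert (Hy := Rabs_im_le (x, y)). simpl in Hx, Hy.
  set (m := Cmod (x, y)) in *.
  assert (m < d1 /\ m < d2 /\ m < d3 /\ m < e) as (L1 & L2 & L3 & L4).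
  { repeat split; eapply Rlt_le_trans; try apply Hw;
    [eapply Rle_trans; [apply Rmin_l | apply Rmin_l]
    |eapply Rle_trans; [apply Rmin_l | apply Rmin_r]
    |eapply Rle_trans; [apply Rmin_r | apply Rmin_l]
    |eapply Rle_trans; [apply Rmin_r | apply Rmin_r]]. }
  specialize (H1 x ltac:(lra)). specialize (H2 y ltac:(lra)). specialize (H3 y ltac:(lra)).
  rewrite exp_0 in H1. rewrite cos_0 in H2. rewrite sin_0 in H3.
  eapply Rle_trans; [apply Cmod_le_sum|].
  unfold Cexp, Cmult, Cminus, Cplus, Copp; simpl. rewrite exp_0, cos_0, sin_0.
  assert (Cc : Rabs (cos y) <= 1) by (pose proof (COS_bound y); apply Rabs_le; lra).
  assert (Hm : 0 <= m) by apply Cmod_ge_0.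
  set (a := exp x - 1 - 1 * x) in *. set (b := cos y - 1 - 0 * y) in *. set (c := sin y - 0 - 1 * y) in *.
  assert (A1 : Rabs a <= e * m) by (pose proof (Rabs_pos x); nra).
  assert (A2 : Rabs b <= e * m) by (pose proof (Rabs_pos y); nra).
  assert (A3 : Rabs c <= e * m) by (pose proof (Rabs_pos y); nra).
  assert (B1 : Rabs (exp x * cos y + - (1 * 1) + - (x * 1 - y * 0)) <= 3 * e * m).
  { replace (exp x * cos y + - (1 * 1) + - (x * 1 - y * 0)) with (a * cos y + (1 + x) * b)
      by (unfold a, b; ring).
    eapply Rle_trans; [apply Rabs_triang|]. rewrite !Rabs_mult.
    assert (Rabs (1 + x) <= 2) by (apply Rabs_le; apply Rabs_le_between in Hx; lra).
    pose proof (Rabs_pos a). pose proof (Rabs_pos b). pose proof (Rabs_pos (cos y)).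
    pose proof (Rabs_pos (1 + x)). nra. }
  assert (B2 : Rabs (exp x * sin y + - (1 * 0) + - (x * 0 + y * 1)) <= 5 * e * m).
  { replace (exp x * sin y + - (1 * 0) + - (x * 0 + y * 1)) with ((a + x) * (c + y) + c)
      by (unfold a, c; ring).
    eapply Rle_trans; [apply Rabs_triang|]. rewrite !Rabs_mult.
    assert (Rabs (a + x) <= 2 * m) by (eapply Rle_trans; [apply Rabs_triang | nra]).
    assert (Rabs (c + y) <= 2 * m) by (eapply Rle_trans; [apply Rabs_triang | nra]).
    pose proof (Rabs_pos (a + x)). pose proof (Rabs_pos (c + y)).
    assert (Rabs (a + x) * Rabs (c + y) <= (2 * m) * (2 * m)) by (apply Rmult_le_compat; lra).
    nra. }
  nra.
Qed.

(** The addition formula transports the derivative at [0] to every point. *)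
Lemma holomorphic_Cexp : holomorphic Cexp.
Proof.
  intros z. exists (Cexp z). apply is_Cderive_eps. intros eps Heps.
  pose proof (exp_pos (fst z)) as Hz.
  assert (He : 0 < eps / exp (fst z)) by now apply Rdiv_lt_0_compat.
  destruct (proj1 (is_Cderive_eps _ _ _) is_Cderive_Cexp_0 _ He) as (d & Hd & H).
  exists d. split; auto. intros w Hw. specialize (H (w - z)%C).
  replace (w - z - 0)%C with (w - z)%C in H by ring. specialize (H Hw).
  replace (Cexp w) with (Cexp z * Cexp (w - z))%C by (rewrite <- Cexp_plus; f_equal; ring).
  assert (E0 : Cexp 0 = RtoC 1).
  { unfold Cexp, RtoC; simpl. rewrite exp_0, cos_0, sin_0. f_equal; ring. }
  rewrite E0 in H.
  replace (Cexp z * Cexp (w - z) - Cexp z - (w - z) * Cexp z)%C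
    with (Cexp z * (Cexp (w - z) - 1 - (w - z) * 1))%C by ring.
  rewrite Cmod_mult, Cmod_Cexp.
  apply Rle_trans with (exp (fst z) * (eps / exp (fst z) * Cmod (w - z))).
  - apply Rmult_le_compat_l; lra.
  - apply Req_le. field. lra.
Qed.

(** The form is the imaginary part of [F dz], and its closedness at a point is the Cauchy-Riemann
    equations. *)
Lemma holomorphic_closed_form (F : C -> C) : holomorphic F ->
  forall x y, closed_form_at (fun x y => snd (F (x, y))) (fun x y => fst (F (x, y))) x y.
Proof.
  intros HF x0 y0. destruct (HF (x0, y0)) as [[l1 l2] Hl].
  exists l2, l1, (- l2). intros eps Heps.
  destruct (proj1 (is_Cderive_eps _ _ _) Hl eps Heps) as (d & Hd & H).
  exists (d / 2). split; [lra|]. intros x y Hx Hy.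
  assert (Hs := Cmod_le_sum ((x, y) - (x0, y0))).
  specialize (H (x, y)). cbn [fst snd Cminus Cplus Copp] in Hs.
  fold (Rminus x x0) in Hs; fold (Rminus y y0) in Hs.
  specialize (H ltac:(lra)).
  assert (H' : Cmod (F (x, y) - F (x0, y0) - ((x, y) - (x0, y0)) * (l1, l2))
    <= eps * (Rabs (x - x0) + Rabs (y - y0))).
  { eapply Rle_trans; [apply H|]. apply Rmult_le_compat_l; lra. }
  clear H Hs.
  destruct (F (x, y)) as [u v] eqn:E1. destruct (F (x0, y0)) as [u0 v0] eqn:E0.
  split; (eapply Rle_trans; [|apply H']).
  - eapply Rle_trans; [|apply Rabs_im_le]. simpl. right. f_equal. ring.
  - eapply Rle_trans; [|apply Rabs_re_le]. simpl. right. f_equal. ring.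
Qed.

Lemma closed_form_cont2 (P Q : R -> R -> R) :
  (forall x y, closed_form_at P Q x y) -> cont2 P /\ cont2 Q.
Proof.
  intros H.
  assert (G : forall (P : R -> R -> R) x0 y0 a b d, 0 < d ->
    (forall x y, Rabs (x - x0) < d -> Rabs (y - y0) < d ->
      Rabs (P x y - (P x0 y0 + a * (x - x0) + b * (y - y0))) <= 1 * (Rabs (x - x0) + Rabs (y - y0))) ->
    continuity_2d_pt P x0 y0).
  { clear. intros P x0 y0 a b d Hd H eps.
    set (K := Rabs a + Rabs b + 2).
    assert (HK : 0 < K) by (unfold K; pose proof (Rabs_pos a); pose proof (Rabs_pos b); lra).
    assert (He : 0 < Rmin d (eps / K))
      by (apply Rmin_pos; [auto | apply Rdiv_lt_0_compat; [apply cond_pos | auto]]).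
    exists (mkposreal _ He). simpl. intros u v Hu Hv.
    pose proof (Rmin_l d (eps / K)). pose proof (Rmin_r d (eps / K)).
    specialize (H u v ltac:(lra) ltac:(lra)).
    set (X := Rabs (u - x0)) in *. set (Y := Rabs (v - y0)) in *.
    assert (HX : X < eps / K) by lra. assert (HY : Y < eps / K) by lra.
    apply Rle_lt_trans with (Rabs a * X + Rabs b * Y + (X + Y)).
    - unfold X, Y in *. rewrite <- !Rabs_mult.
      replace (P u v - P x0 y0) with ((P u v - (P x0 y0 + a * (u - x0) + b * (v - y0))) + (a * (u - x0) + b * (v - y0))) by ring.
      eapply Rle_trans; [apply Rabs_triang|].
      pose proof (Rabs_triang (a * (u - x0)) (b * (v - y0))). lra.
    - replace (pos eps) with (K * (eps / K)) by (field; lra).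
      unfold K at 1. pose proof (Rabs_pos a). pose proof (Rabs_pos b). nra. }
  split; intros x y; destruct (H x y) as (a & b & c & Habc);
    destruct (Habc 1 ltac:(lra)) as (d & Hd & Hd'); eapply G; eauto; intros; now apply Hd'.
Qed.

Lemma holomorphic_cont2_re (F : C -> C) : holomorphic F -> cont2 (fun x y => fst (F (x, y))).
Proof. intros HF. apply (closed_form_cont2 _ _ (holomorphic_closed_form F HF)). Qed.

Lemma holomorphic_cont2_im (F : C -> C) : holomorphic F -> cont2 (fun x y => snd (F (x, y))).
Proof. intros HF. apply (closed_form_cont2 _ _ (holomorphic_closed_form F HF)). Qed.

Lemma Cmod_continuous (F : C -> C) :
  cont2 (fun x y => fst (F (x, y))) -> cont2 (fun x y => snd (F (x, y))) ->
  cont2 (fun x y => Cmod (F (x, y))).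
Proof.
  intros H1 H2. unfold Cmod.
  apply (cont2_comp1 sqrt (fun x y => fst (F (x, y)) ^ 2 + snd (F (x, y)) ^ 2)).
  - intros; apply continuous_sqrt.
  - apply (cont2_ext (fun x y => fst (F (x, y)) * fst (F (x, y)) + snd (F (x, y)) * snd (F (x, y)))).
    + intros; ring.
    + apply cont2_plus; now apply cont2_mult.
Qed.

Lemma holomorphic_cont2_Cmod (F : C -> C) : holomorphic F -> cont2 (fun x y => Cmod (F (x, y))).
Proof.
  intros HF. apply Cmod_continuous;
    [now apply holomorphic_cont2_re | now apply holomorphic_cont2_im].
Qed.

Definition circle (z : C) (r t : R) : C := (fst z + r * cos t, snd z + r * sin t).

(* Goursat's lemma for [F (z + exp _)] on rectangles of height [2 PI] and width tending to infinity:
   the horizontal sides cancel by periodicity. *)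
Lemma mean_value_re (F : C -> C) (z : C) (r : R) : holomorphic F -> 0 < r ->
  RInt (fun t => fst (F (circle z r t))) 0 (2 * PI) = 2 * PI * fst (F z).
Proof.
  intros HF Hr. pose proof PI_RGT_0 as Hpi.
  set (G := fun w => F (1 * Cexp w + z)%C).
  assert (HG : holomorphic G).
  { apply (holomorphic_comp (fun w => F (1 * w + z)%C) Cexp); [|apply holomorphic_Cexp].
    apply (holomorphic_comp F (fun w => 1 * w + z)%C); auto. apply holomorphic_affine. }
  assert (EG : forall s t, G (s, t) = F (circle z (exp s) t)).
  { intros s t. unfold G, circle. f_equal. destruct z as [x y].
    unfold Cexp, Cmult, Cplus, RtoC; simpl. f_equal; ring. }
  assert (Hconst : forall s, s <= ln r ->
    RInt (fun t => fst (F (circle z r t))) 0 (2 * PI) = RInt (fun t => fst (F (circle z (exp s) t))) 0 (2 * PI)).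
  { intros s Hs.
    pose proof (goursat _ _ (holomorphic_cont2_im G HG) (holomorphic_cont2_re G HG) s 0 (ln r - s) (2 * PI)
      ltac:(lra) ltac:(lra) (holomorphic_closed_form G HG)) as E.
    unfold circulation in E.
    replace (s + (ln r - s)) with (ln r) in E by ring. rewrite Rplus_0_l in E.
    assert (E1 : RInt (fun t => snd (G (t, 0))) s (ln r) = RInt (fun t => snd (G (t, 2 * PI))) s (ln r)).
    { apply RInt_ext. intros t _. rewrite !EG. unfold circle.
      rewrite cos_2PI, sin_2PI, cos_0, sin_0. reflexivity. }
    assert (E2 : RInt (fun t => fst (G (ln r, t))) 0 (2 * PI) = RInt (fun t => fst (F (circle z r t))) 0 (2 * PI)).
    { apply RInt_ext. intros t _. rewrite EG, exp_ln by auto. reflexivity. }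
    assert (E3 : RInt (fun t => fst (G (s, t))) 0 (2 * PI) = RInt (fun t => fst (F (circle z (exp s) t))) 0 (2 * PI)).
    { apply RInt_ext. intros t _. rewrite EG. reflexivity. }
    rewrite E1, E2, E3 in E. lra. }
  set (I := RInt (fun t => fst (F (circle z r t))) 0 (2 * PI)) in *.
  (* As [s] tends to minus infinity the circle of radius [exp s] shrinks to [z], where the real part
     of [F] is continuous. *)
  assert (Hsmall : forall eps, 0 < eps -> Rabs (I - 2 * PI * fst (F z)) <= 2 * PI * eps).
  { intros eps Heps.
    destruct (holomorphic_cont2_re F HF (fst z) (snd z) (mkposreal eps Heps)) as [d Hd]. simpl in Hd.
    assert (Hsx : exists s, s <= ln r /\ exp s < d).
    { exists (Rmin (ln r) (ln (d / 2))). split; [apply Rmin_l|].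
      apply Rle_lt_trans with (d / 2).
      - rewrite <- (exp_ln (d / 2)) at 2 by (pose proof (cond_pos d); lra).
        destruct (Rle_lt_or_eq_dec _ _ (Rmin_r (ln r) (ln (d / 2)))) as [H | H].
        + left. now apply exp_increasing.
        + rewrite H. lra.
      - pose proof (cond_pos d); lra. }
    destruct Hsx as (s & Hs & Hds). rewrite (Hconst s Hs).
    assert (Hc : forall t, continuous (fun t => fst (F (circle z (exp s) t))) t).
    { intros t. apply continuous_ext with (fun t => fst (G (s, t))).
      - intros u. now rewrite EG.
      - apply (cont2_slice_r (fun s t => fst (G (s, t)))). now apply holomorphic_cont2_re. }
    assert (E : RInt (fun t => fst (F (circle z (exp s) t))) 0 (2 * PI) - 2 * PI * fst (F z)
      = RInt (fun t => fst (F (circle z (exp s) t)) - fst (F z)) 0 (2 * PI)).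
    { symmetry. transitivity (RInt (fun t => fst (F (circle z (exp s) t))) 0 (2 * PI) - RInt (fun _ => fst (F z)) 0 (2 * PI)).
      - apply (@RInt_minus R_CompleteNormedModule); [now apply continuous_ex_RInt | apply ex_RInt_const].
      - f_equal. rewrite RInt_const. unfold scal; simpl; unfold mult; simpl. ring. }
    rewrite E. replace (2 * PI * eps) with ((2 * PI - 0) * eps) by ring.
    apply abs_RInt_le_const; [lra| |].
    - apply (@ex_RInt_minus R_NormedModule (fun t => fst (F (circle z (exp s) t))));
        [now apply continuous_ex_RInt | apply ex_RInt_const].
    - intros t _. left. destruct z as [x y]. unfold circle; simpl in *. pose proof (exp_pos s) as He.
      assert (Habs : forall q, -1 <= q <= 1 -> forall x, Rabs (x + exp s * q - x) < d).
      { intros q Hq x'. replace (x' + exp s * q - x') with (exp s * q) by ring.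
        rewrite Rabs_mult, (Rabs_pos_eq (exp s)) by lra.
        assert (Rabs q <= 1) by (apply Rabs_le; lra). pose proof (Rabs_pos q). nra. }
      apply Hd; apply Habs; [apply COS_bound | apply SIN_bound]. }
  destruct (Req_dec (I - 2 * PI * fst (F z)) 0) as [|Hne]; [lra|exfalso].
  pose proof (Rabs_pos_lt _ Hne) as Hp.
  specialize (Hsmall (Rabs (I - 2 * PI * fst (F z)) / (4 * PI)) ltac:(apply Rdiv_lt_0_compat; lra)).
  replace (2 * PI * (Rabs (I - 2 * PI * fst (F z)) / (4 * PI))) with (Rabs (I - 2 * PI * fst (F z)) / 2) in Hsmall by (field; lra).
  lra.
Qed.

Lemma cont2_circle (G : R -> R -> R) z r : cont2 G ->
  forall t, continuous (fun t => G (fst z + r * cos t) (snd z + r * sin t)) t.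
Proof.
  intros HG. apply (cont2_slice_r (fun _ t => G (fst z + r * cos t) (snd z + r * sin t)) 0).
  apply (cont2_comp G); auto; apply cont2_snd; intros t;
    apply (continuous_plus (V := R_NormedModule) (fun _ => _) (fun t => r * _ t));
    try apply continuous_const; apply (continuous_scal_r (V := R_NormedModule));
    [apply continuous_cos | apply continuous_sin].
Qed.

(** After a rotation of the values, the real part equals the modulus at the centre and is at most
    the modulus on the circle; so the mean value property of real parts is enough. *)
Lemma sub_mean_Cmod (F : C -> C) (z : C) (r : R) : holomorphic F -> 0 < r ->
  2 * PI * Cmod (F z) <= RInt (fun t => Cmod (F (circle z r t))) 0 (2 * PI).
Proof.
  intros HF Hr. pose proof PI_RGT_0 as Hpi.
  assert (Hc : forall F : C -> C, holomorphic F -> ex_RInt (fun t => Cmod (F (circle z r t))) 0 (2 * PI)).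
  { intros H HH. apply continuous_ex_RInt.
    apply (cont2_circle (fun x y => Cmod (H (x, y)))). now apply holomorphic_cont2_Cmod. }
  destruct (Req_dec (Cmod (F z)) 0) as [E0 | Hne].
  { rewrite E0, Rmult_0_r. apply RInt_ge_0; [lra | now apply Hc | intros; apply Cmod_ge_0]. }
  pose proof (Cmod_ge_0 (F z)) as Hge.
  set (m := Cmod (F z)) in *.
  (* rotate the values so that [F z] becomes a positive real *)
  set (c := (fst (F z) / m, - snd (F z) / m)).
  assert (Hm2 : fst (F z) * fst (F z) + snd (F z) * snd (F z) = m * m).
  { unfold m, Cmod. rewrite sqrt_sqrt; [ring | nra]. }
  assert (Hcm : Cmod c = 1).
  { unfold Cmod, c; simpl. transitivity (sqrt 1); [|apply sqrt_1]. f_equal.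
    transitivity ((fst (F z) * fst (F z) + snd (F z) * snd (F z)) / (m * m)); [field; auto|].
    rewrite Hm2. field; auto. }
  set (H := fun w => (c * F w)%C).
  assert (HH : holomorphic H).
  { apply (holomorphic_comp (fun w => (c * w)%C) F); auto.
    intros w. destruct (holomorphic_affine c 0 w) as [l Hl]. exists l.
    eapply (is_derive_ext (K := C_AbsRing)); [|apply Hl]. intros t. simpl. apply Cplus_0_r. }
  assert (E := mean_value_re H z r HH Hr).
  assert (Ez : fst (H z) = m).
  { unfold H, c, Cmult; simpl.
    transitivity ((fst (F z) * fst (F z) + snd (F z) * snd (F z)) / m); [field; auto|].
    rewrite Hm2. field; auto. }
  rewrite Ez in E. rewrite <- E.
  apply RInt_le; [lra | | now apply Hc |].
  - apply continuous_ex_RInt. apply (cont2_circle (fun x y => fst (H (x, y)))).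
    now apply holomorphic_cont2_re.
  - intros t _. eapply Rle_trans; [apply Rle_abs|]. eapply Rle_trans; [apply Rabs_re_le|].
    unfold H. rewrite Cmod_mult, Hcm. lra.
Qed.

(** * Log-convexity of the means *)

Lemma rpow_pos x a : 0 < x -> rpow x a = Rpower x a.
Proof. intros H. unfold rpow. destruct Rle_dec; simpl; [lra | reflexivity]. Qed.

Lemma rpow_nonpos x a : x <= 0 -> rpow x a = 0.
Proof. intros H. unfold rpow. destruct Rle_dec; simpl; [reflexivity | lra]. Qed.

Lemma rpow_ge_0 x a : 0 <= rpow x a.
Proof. unfold rpow. destruct Rle_dec; simpl; [lra | left; apply exp_pos]. Qed.

Lemma continuous_Rpower_base x a : 0 < x -> continuous (fun y => Rpower y a) x.
Proof.
  intros Hx. apply (ex_derive_continuous (V := R_NormedModule)). exists (a * Rpower x (a - 1)).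
  apply is_derive_Reals. now apply derivable_pt_lim_power.
Qed.

Lemma continuous_rpow p : 0 < p -> forall x, continuous (fun y => rpow y p) x.
Proof.
  intros Hp x. destruct (Rtotal_order x 0) as [Hx | [-> | Hx]].
  - apply continuous_ext_loc with (fun _ => 0); [|apply continuous_const].
    apply (filter_imp (fun y => y < 0)); [|now apply open_lt].
    intros y Hy. rewrite rpow_nonpos; [reflexivity | lra].
  - apply continuity_pt_filterlim, continuity_pt_locally. intros eps.
    (* The radius is [eps ^ (1 / p)]. *)
    exists (mkposreal _ (exp_pos (ln eps / p))). intros y Hy.
    rewrite (rpow_nonpos 0) by lra. rewrite Rminus_0_r, Rabs_pos_eq by apply rpow_ge_0.
    destruct (Rle_dec y 0) as [Hy0 | Hy0].
    { rewrite rpow_nonpos by lra. apply cond_pos. }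
    rewrite rpow_pos by lra. unfold Rpower.
    change (Rabs (y - 0) < exp (ln eps / p)) in Hy.
    rewrite Rminus_0_r, Rabs_pos_eq in Hy by lra.
    rewrite <- (exp_ln eps (cond_pos eps)). apply exp_increasing.
    apply ln_increasing in Hy; [|lra]. rewrite ln_exp in Hy.
    apply Rmult_lt_compat_l with (r := p) in Hy; [|lra].
    replace (p * (ln eps / p)) with (ln eps) in Hy by (field; lra). lra.
  - apply continuous_ext_loc with (fun y => Rpower y p).
    + apply (filter_imp (fun y => 0 < y)); [|now apply open_gt].
      intros y Hy. now rewrite rpow_pos.
    + now apply continuous_Rpower_base.
Qed.

(** Convexity of the [p]-th power: its graph lies above the tangent line at [m], also at [y = 0],
    where [rpow] takes the value [0]. *)
Lemma rpow_tangent p m y : 1 <= p -> 0 < m -> 0 <= y ->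
  rpow m p + p * Rpower m (p - 1) * (y - m) <= rpow y p.
Proof.
  intros Hp Hm [Hy | <-].
  - rewrite !rpow_pos by lra.
    assert (Em : Rpower m p = m * Rpower m (p - 1)).
    { rewrite <- (Rpower_1 m) at 2 by lra. rewrite <- Rpower_plus. f_equal; ring. }
    set (s := y / m). assert (Hs : 0 < s) by now apply Rdiv_lt_0_compat.
    assert (Ey : y = s * m) by (unfold s; field; lra).
    assert (Rpower y p = Rpower s p * Rpower m p) as E by (rewrite Ey; symmetry; now apply Rpower_mult_distr).
    rewrite E, Ey, Em.
    pose proof (exp_pos ((p - 1) * ln m)) as Hpos. change (0 < Rpower m (p - 1)) in Hpos.
    (* Bernoulli's inequality, from [exp a >= exp b * (1 + a - b)] at [b = ln s] *)
    assert (HB : 1 + p * (s - 1) <= Rpower s p).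
    { unfold Rpower. set (v := ln s). assert (Es : s = exp v) by (symmetry; now apply exp_ln).
      pose proof (exp_ineq1_le ((p - 1) * v)) as H1. pose proof (exp_ineq1_le (- v)) as H2.
      pose proof (exp_pos v) as Hv.
      assert (E1 : exp (p * v) = exp v * exp ((p - 1) * v)) by (rewrite <- exp_plus; f_equal; ring).
      assert (E2 : 1 = exp v * exp (- v)) by (rewrite <- exp_plus, Rplus_opp_r, exp_0; reflexivity).
      rewrite E1, Es.
      apply Rmult_le_compat_l with (r := exp v) in H1; [|lra].
      apply Rmult_le_compat_l with (r := exp v) in H2; [|lra].
      rewrite <- E2 in H2. nra. }
    assert (0 < m * Rpower m (p - 1)) by nra. nra.
  - rewrite (rpow_nonpos 0) by lra. rewrite rpow_pos by lra.
    assert (Em : Rpower m p = m * Rpower m (p - 1)).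
    { rewrite <- (Rpower_1 m) at 2 by lra. rewrite <- Rpower_plus. f_equal; ring. }
    rewrite Em. pose proof (exp_pos ((p - 1) * ln m)) as Hpos. change (0 < Rpower m (p - 1)) in Hpos.
    assert (0 < m * Rpower m (p - 1)) by nra. nra.
Qed.

Lemma cont2_rpow_Cmod (F : C -> C) p : 0 < p -> holomorphic F ->
  cont2 (fun x y => rpow (Cmod (F (x, y))) p).
Proof.
  intros Hp HF. apply (cont2_comp1 (fun y => rpow y p)); [intros; now apply continuous_rpow|].
  now apply holomorphic_cont2_Cmod.
Qed.

(** Jensen's inequality by way of the tangent line at [m = Cmod (F z)]: the line integrates exactly,
    its slope [k] is positive, and [sub_mean_Cmod] then bounds its integral from below. *)
Lemma sub_mean_rpow (F : C -> C) (z : C) (r p : R) : 1 <= p -> holomorphic F -> 0 < r ->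
  2 * PI * rpow (Cmod (F z)) p <= RInt (fun t => rpow (Cmod (F (circle z r t))) p) 0 (2 * PI).
Proof.
  intros Hp HF Hr. pose proof PI_RGT_0 as Hpi.
  assert (Hi : ex_RInt (fun t => rpow (Cmod (F (circle z r t))) p) 0 (2 * PI)).
  { apply continuous_ex_RInt. apply (cont2_circle (fun x y => rpow (Cmod (F (x, y))) p)).
    apply cont2_rpow_Cmod; auto; lra. }
  assert (Hi1 : ex_RInt (fun t => Cmod (F (circle z r t))) 0 (2 * PI)).
  { apply continuous_ex_RInt. apply (cont2_circle (fun x y => Cmod (F (x, y)))).
    now apply holomorphic_cont2_Cmod. }
  destruct (Cmod_ge_0 (F z)) as [Hm | E0].
  2:{ rewrite <- E0, rpow_nonpos, Rmult_0_r by lra.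
      apply RInt_ge_0; [lra | auto | intros; apply rpow_ge_0]. }
  set (m := Cmod (F z)) in *. set (k := p * Rpower m (p - 1)).
  assert (Hk : 0 < k) by (apply Rmult_lt_0_compat; [lra | apply exp_pos]).
  assert (HS := sub_mean_Cmod F z r HF Hr). fold m in HS.
  apply Rle_trans with (RInt (fun t => (rpow m p - k * m) + k * Cmod (F (circle z r t))) 0 (2 * PI)).
  - assert (E : RInt (fun t => (rpow m p - k * m) + k * Cmod (F (circle z r t))) 0 (2 * PI)
      = 2 * PI * (rpow m p - k * m) + k * RInt (fun t => Cmod (F (circle z r t))) 0 (2 * PI)).
    { transitivity (RInt (fun _ => rpow m p - k * m) 0 (2 * PI) + RInt (fun t => k * Cmod (F (circle z r t))) 0 (2 * PI)).
      - apply (@RInt_plus R_CompleteNormedModule); [apply ex_RInt_const|].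
        now apply (@ex_RInt_scal R_NormedModule (fun t => Cmod (F (circle z r t)))).
      - f_equal.
        + rewrite RInt_const. unfold scal; simpl; unfold mult; simpl. ring.
        + now apply (@RInt_scal R_CompleteNormedModule (fun t => Cmod (F (circle z r t)))). }
    rewrite E. nra.
  - apply RInt_le; [lra | | auto |].
    + apply (@ex_RInt_plus R_NormedModule (fun _ => rpow m p - k * m)); [apply ex_RInt_const|].
      now apply (@ex_RInt_scal R_NormedModule (fun t => Cmod (F (circle z r t)))).
    + intros t _. pose proof (rpow_tangent p m (Cmod (F (circle z r t))) Hp Hm (Cmod_ge_0 _)).
      fold k in H. lra.
Qed.

(** The hypothesis says that [G], as a function of the real part alone, has the sub-mean value
    property on circles, which project to [s + r cos t]. Adding a small multiple of [(t - x)^2]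
    makes the inequality strict and so excludes an interior maximum. *)
Lemma sub_mean_max_principle (G : R -> R) a b x :
  (forall t, continuous G t) ->
  (forall s r, 0 < r -> 2 * PI * G s <= RInt (fun t => G (s + r * cos t)) 0 (2 * PI)) ->
  a <= x <= b -> G x <= Rmax (G a) (G b).
Proof.
  intros HG Hsub Hx. pose proof PI_RGT_0 as Hpi.
  destruct (Rle_dec (G x) (Rmax (G a) (G b))) as [|Hn]; [auto | exfalso].
  apply Rnot_le_lt in Hn.
  assert (Ha : G a < G x) by (eapply Rle_lt_trans; [apply Rmax_l | eauto]).
  assert (Hb : G b < G x) by (eapply Rle_lt_trans; [apply Rmax_r | eauto]).
  set (K := (b - a) * (b - a) + 1).
  assert (HK : 0 < K) by (unfold K; pose proof (Rle_0_sqr (b - a)); unfold Rsqr in *; lra).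
  (* Small enough that the perturbation, at most [eps (b - a)^2] on [[a, b]], does not lift the
     endpoint values up to [G x]. *)
  set (eps := (G x - Rmax (G a) (G b)) / K).
  assert (Heps : 0 < eps) by (apply Rdiv_lt_0_compat; lra).
  assert (HepsK : eps * K = G x - Rmax (G a) (G b)) by (unfold eps; field; lra).
  set (H := fun t => G t + eps * ((t - x) * (t - x))).
  assert (HcH : forall t, continuous H t).
  { intros t. apply (continuous_plus (V := R_NormedModule) G); [apply HG|].
    apply (ex_derive_continuous (V := R_NormedModule)). auto_derive. auto. }
  assert (Hend : forall t, t = a \/ t = b -> H t < H x).
  { intros t Ht. unfold H. replace ((x - x) * (x - x)) with 0 by ring.
    assert (G t <= Rmax (G a) (G b)) by (destruct Ht; subst t; [apply Rmax_l | apply Rmax_r]).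
    assert ((t - x) * (t - x) <= (b - a) * (b - a)) by (destruct Ht; subst t; nra).
    assert (eps * ((t - x) * (t - x)) < eps * K) by (apply Rmult_lt_compat_l; unfold K; lra).
    lra. }
  destruct (continuity_ab_maj H a b) as (m & Hmax & Hm); [lra | |].
  { intros t _. apply continuity_pt_filterlim, HcH. }
  assert (Hxm : H x <= H m) by (apply Hmax; lra).
  assert (Hma : m <> a) by (intros ->; pose proof (Hend a (or_introl eq_refl)); lra).
  assert (Hmb : m <> b) by (intros ->; pose proof (Hend b (or_intror eq_refl)); lra).
  (* The largest radius for which the projected circle stays in [[a, b]]. *)
  set (r := Rmin (m - a) (b - m)).
  assert (Hr : 0 < r) by (apply Rmin_pos; lra).
  assert (Hr1 : r <= m - a) by apply Rmin_l. assert (Hr2 : r <= b - m) by apply Rmin_r.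
  assert (Hcos : forall t, continuous (fun t => m + r * cos t) t).
  { intros t. apply (ex_derive_continuous (V := R_NormedModule)). auto_derive. auto. }
  assert (Hcc : forall g : R -> R, (forall t, continuous g t) -> ex_RInt (fun t => g (m + r * cos t)) 0 (2 * PI)).
  { intros g Hg. apply continuous_ex_RInt. intros t. apply (continuous_comp (fun t => m + r * cos t) g); auto. }
  assert (Hup : RInt (fun t => H (m + r * cos t)) 0 (2 * PI) <= 2 * PI * H m).
  { assert (E : 2 * PI * H m = RInt (fun _ => H m) 0 (2 * PI)).
    { rewrite RInt_const. unfold scal; simpl; unfold mult; simpl. ring. }
    rewrite E. apply RInt_le; [lra | now apply Hcc | apply ex_RInt_const |].
    intros t _. apply Hmax. pose proof (COS_bound t). nra. }
  set (q := fun t => eps * ((t - x) * (t - x))).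
  assert (Hcq : forall t, continuous q t).
  { intros t. apply (ex_derive_continuous (V := R_NormedModule)). unfold q. auto_derive. auto. }
  (* The circular average of [q] exceeds [q m] by [eps r^2 / 2]; this is the strictness. *)
  assert (Eq : RInt (fun t => q (m + r * cos t)) 0 (2 * PI) = eps * (2 * PI * ((m - x) * (m - x)) + PI * (r * r))).
  { set (A := fun t => eps * ((m - x) * (m - x) * t + 2 * (m - x) * r * sin t + r * r * ((t + sin t * cos t) / 2))).
    assert (HI : is_RInt (fun t => q (m + r * cos t)) 0 (2 * PI) (minus (A (2 * PI)) (A 0))).
    { apply (is_RInt_derive A).
      - intros t _. unfold A. auto_derive; auto. unfold q.
        pose proof (sin2_cos2 t) as Hsc. unfold Rsqr in Hsc.
        replace (sin t * (1 * - sin t)) with (cos t * cos t - 1) by lra. field.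
      - intros t _. apply (continuous_comp (fun t => m + r * cos t) q); auto. }
    rewrite (is_RInt_unique _ _ _ _ HI). unfold minus, plus, opp, A; simpl.
    rewrite sin_2PI, sin_0. field. }
  assert (Esum : RInt (fun t => H (m + r * cos t)) 0 (2 * PI)
     = RInt (fun t => G (m + r * cos t)) 0 (2 * PI) + RInt (fun t => q (m + r * cos t)) 0 (2 * PI)).
  { apply (@RInt_plus R_CompleteNormedModule (fun t => G (m + r * cos t)) (fun t => q (m + r * cos t)));
      now apply Hcc. }
  rewrite Esum, Eq in Hup. specialize (Hsub m r Hr).
  unfold H in Hup.
  assert (0 < eps * (PI * (r * r))) by (apply Rmult_lt_0_compat; [lra | apply Rmult_lt_0_compat; [lra | nra]]).
  lra.
Qed.

Definition mean_pow (f : C -> C) (p r : R) : R :=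
  RInt (fun t => rpow (Cmod (f (r * cos t, r * sin t))) p) 0 (2 * PI).

Section MeanPow.
Variables (f : C -> C) (p : R).
Hypothesis Hp : 1 <= p.
Hypothesis Hf : holomorphic f.

Let cont_polar : cont2 (fun r t => rpow (Cmod (f (r * cos t, r * sin t))) p).
Proof.
  apply (cont2_comp (fun x y => rpow (Cmod (f (x, y))) p)); [apply cont2_rpow_Cmod; auto; lra | |];
    apply cont2_mult; (apply cont2_fst || apply cont2_snd); intros;
    [apply continuous_id | apply continuous_cos | apply continuous_id | apply continuous_sin].
Qed.

Lemma mean_pow_continuous r : continuous (mean_pow f p) r.
Proof. exact (RInt_param_continuous _ 0 (2 * PI) cont_polar r). Qed.

Lemma mean_pow_ge_0 r : 0 <= mean_pow f p r.
Proof.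
  apply RInt_ge_0; [pose proof PI_RGT_0; lra | | intros; apply rpow_ge_0].
  apply continuous_ex_RInt. apply (cont2_slice_r _ r cont_polar).
Qed.

(* [exp (beta s) * mean_pow (exp s)] is the average over a period of the subharmonic function
   [|exp (beta w / p) * f (exp w)| ^ p]. *)
Lemma mean_pow_log_sub_mean beta s r : 0 < r ->
  2 * PI * (exp (beta * s) * mean_pow f p (exp s))
  <= RInt (fun t => exp (beta * (s + r * cos t)) * mean_pow f p (exp (s + r * cos t))) 0 (2 * PI).
Proof.
  intros Hr. pose proof PI_RGT_0 as Hpi.
  set (g := fun w => (Cexp (RtoC (beta / p) * w + 0) * f (Cexp w))%C).
  assert (Hg : holomorphic g).
  { apply holomorphic_mult.
    - apply (holomorphic_comp Cexp); [apply holomorphic_Cexp | apply holomorphic_affine].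
    - apply holomorphic_comp; [exact Hf | apply holomorphic_Cexp]. }
  set (V := fun s t => rpow (Cmod (g (s, t))) p).
  assert (HV : cont2 V) by (apply cont2_rpow_Cmod; auto; lra).
  assert (EV : forall s t, V s t = exp (beta * s) * rpow (Cmod (f (exp s * cos t, exp s * sin t))) p).
  { intros s' t. unfold V, g. rewrite Cmod_mult, Cmod_Cexp.
    change (Cexp (s', t)) with (exp s' * cos t, exp s' * sin t).
    replace (fst (RtoC (beta / p) * (s', t) + 0)%C) with (beta / p * s') by (simpl; ring).
    set (y := Cmod _). destruct (Rle_lt_or_eq_dec 0 y (Cmod_ge_0 _)) as [Hy | <-].
    - pose proof (exp_pos (beta / p * s')). rewrite !rpow_pos by nra.
      rewrite <- Rpower_mult_distr by assumption. f_equal.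
      unfold Rpower. rewrite ln_exp. f_equal. field. lra.
    - rewrite Rmult_0_r, rpow_nonpos by lra. ring. }
  set (Phi := fun s => exp (beta * s) * mean_pow f p (exp s)).
  assert (EPhi : forall s, Phi s = RInt (V s) 0 (2 * PI)).
  { intros s'. unfold Phi, mean_pow. symmetry.
    rewrite (RInt_ext _ _ 0 (2 * PI) (fun t _ => EV s' t)).
    apply (@RInt_scal R_CompleteNormedModule (fun t => rpow (Cmod (f (exp s' * cos t, exp s' * sin t))) p)).
    apply continuous_ex_RInt, (cont2_slice_r _ (exp s') cont_polar). }
  (* For general [beta] the function [g] is not periodic in the imaginary direction, but its modulus
     is. *)
  assert (Hper : forall s t, V s (t + 2 * PI) = V s t).
  { intros s' t. rewrite !EV. now rewrite cos_plus, sin_plus, cos_2PI, sin_2PI, !Rmult_1_r, !Rmult_0_r, Rminus_0_r, Rplus_0_r. }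
  assert (Hshift : forall s c, RInt (fun t => V s (t + c)) 0 (2 * PI) = RInt (V s) 0 (2 * PI)).
  { intros s' c.
    assert (HVs : forall t, continuous (V s') t) by now apply cont2_slice_r.
    pose proof (RInt_comp_lin (V s') 1 c 0 (2 * PI) (continuous_ex_RInt _ _ _ HVs)) as E.
    rewrite <- (RInt_periodic (V s') (2 * PI) c HVs (Hper s')).
    replace (1 * 0 + c) with c in E by ring. replace (1 * (2 * PI) + c) with (c + 2 * PI) in E by ring.
    rewrite <- E. apply RInt_ext. intros t _. unfold scal; simpl; unfold mult; simpl.
    rewrite !Rmult_1_l. reflexivity. }
  change (2 * PI * Phi s <= RInt (fun t => Phi (s + r * cos t)) 0 (2 * PI)).
  (* The sub-mean inequality for [g] at [(s, th)] is averaged over [th]. After Fubini the integral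
     over [th] covers a full period, so the shift [r sin t] drops out. *)
  set (W := fun th t => V (s + r * cos t) (th + r * sin t)).
  assert (HW : cont2 W).
  { assert (Hc : cont2 (fun _ t => r * cos t) /\ cont2 (fun _ t => r * sin t)).
    { split; apply cont2_snd; intros t; apply (ex_derive_continuous (V := R_NormedModule)); auto_derive; auto. }
    apply (cont2_comp V); auto; apply cont2_plus; try apply Hc; apply cont2_fst; intros t;
      [apply continuous_const | apply continuous_id]. }
  assert (E : RInt (fun t => Phi (s + r * cos t)) 0 (2 * PI) = RInt (fun th => RInt (fun t => W th t) 0 (2 * PI)) 0 (2 * PI)).
  { rewrite RInt_fubini by exact HW. apply RInt_ext. intros t _.
    rewrite EPhi. symmetry. apply (Hshift (s + r * cos t) (r * sin t)). }
  rewrite E, EPhi.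
  assert (E2 : 2 * PI * RInt (V s) 0 (2 * PI) = RInt (fun th => 2 * PI * V s th) 0 (2 * PI)).
  { symmetry. apply (@RInt_scal R_CompleteNormedModule (V s)). now apply continuous_ex_RInt, cont2_slice_r. }
  rewrite E2. apply RInt_le; [lra | | |].
  - apply (@ex_RInt_scal R_NormedModule (V s)). now apply continuous_ex_RInt, cont2_slice_r.
  - apply continuous_ex_RInt. now apply RInt_param_continuous.
  - intros th _. exact (sub_mean_rpow g (s, th) r p Hp Hg Hr).
Qed.

(** The maximum principle in the variable [ln r]; for all [beta] together it amounts to convexity of
    the logarithm of the means in [ln r]. *)
Lemma mean_pow_max_principle beta x y z : 0 < x -> x <= y -> y <= z ->
  Rpower y beta * mean_pow f p y
  <= Rmax (Rpower x beta * mean_pow f p x) (Rpower z beta * mean_pow f p z).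
Proof.
  intros Hx Hxy Hyz.
  pose proof (sub_mean_max_principle (fun s => exp (beta * s) * mean_pow f p (exp s)) (ln x) (ln z) (ln y)) as H.
  cbv beta in H. rewrite !exp_ln in H by lra. apply H.
  - intros s. apply (continuous_mult (K := R_AbsRing)).
    + apply (ex_derive_continuous (V := R_NormedModule)). auto_derive. auto.
    + apply (continuous_comp exp (mean_pow f p)); [apply continuous_exp | apply mean_pow_continuous].
  - apply mean_pow_log_sub_mean.
  - split; apply Rcomplements.ln_le; lra.
Qed.
End MeanPow.

(** * Polar coordinates *)

Definition square_integral (k : R -> R -> R) (b : R) : R :=
  RInt (fun x => RInt (fun y => k x y) (- b) b) (- b) b.

Lemma RInt_le_enlarge (f : R -> R) a b c d :
  (forall x, continuous f x) -> (forall x, c <= x <= d -> 0 <= f x) ->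
  c <= a -> a <= b -> b <= d -> RInt f a b <= RInt f c d.
Proof.
  intros Hf H0 Hca Hab Hbd.
  assert (Hi : forall a b, ex_RInt f a b) by (intros; now apply continuous_ex_RInt).
  pose proof (RInt_Chasles f c a d (Hi _ _) (Hi _ _)) as E1.
  pose proof (RInt_Chasles f a b d (Hi _ _) (Hi _ _)) as E2.
  assert (0 <= RInt f c a) by (apply RInt_ge_0; auto; intros; apply H0; lra).
  assert (0 <= RInt f b d) by (apply RInt_ge_0; auto; intros; apply H0; lra).
  unfold plus in *; simpl in *. lra.
Qed.

Lemma RInt_scal_R (f : R -> R) c a b : (forall x, continuous f x) ->
  RInt (fun x => c * f x) a b = c * RInt f a b.
Proof.
  intros Hf. apply (@RInt_scal R_CompleteNormedModule f). now apply continuous_ex_RInt.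
Qed.

Lemma RInt_comp_lin_R (f : R -> R) u v a b : (forall x, continuous f x) ->
  RInt (fun y => u * f (u * y + v)) a b = RInt f (u * a + v) (u * b + v).
Proof.
  intros Hf. apply (@RInt_comp_lin R_CompleteNormedModule f). now apply continuous_ex_RInt.
Qed.

(** A quarter turn is a reflection combined with an exchange of the variables, and the exchange is
    Fubini. *)
Lemma square_integral_rot (k : R -> R -> R) b : cont2 k ->
  square_integral (fun x y => k (- y) x) b = square_integral k b.
Proof.
  intros Hk. unfold square_integral.
  rewrite (RInt_ext _ (fun x => RInt (fun y => k y x) (- b) b)).
  - symmetry. now apply RInt_fubini.
  - intros x _. pose proof (RInt_comp_lin_R (fun y => k y x) (-1) 0 b (- b) (cont2_slice_l _ x Hk)) as E.
    replace (-1 * b + 0) with (- b) in E by ring. replace (-1 * - b + 0) with b in E by ring.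
    assert (Hc : forall y, continuous (fun y => k (-1 * y + 0) x) y).
    { intros y. apply (continuous_comp (fun y => -1 * y + 0) (fun y => k y x)).
      - apply (ex_derive_continuous (V := R_NormedModule)). auto_derive. auto.
      - now apply cont2_slice_l. }
    rewrite <- E, RInt_scal_R by exact Hc.
    pose proof (opp_RInt_swap (fun y => k (-1 * y + 0) x) b (- b) (continuous_ex_RInt _ _ _ Hc)) as E2.
    unfold opp in E2; simpl in E2.
    rewrite (RInt_ext (fun y => k (- y) x) (fun y => k (-1 * y + 0) x)).
    + lra.
    + intros y _. f_equal. ring.
Qed.

Lemma cont2_polar (k : R -> R -> R) : cont2 k -> cont2 (fun r t => k (r * cos t) (r * sin t)).
Proof.
  intros Hk. apply (cont2_comp k); auto; apply cont2_mult; (apply cont2_fst || apply cont2_snd); intros;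
    [apply continuous_id | apply continuous_cos | apply continuous_id | apply continuous_sin].
Qed.

Ltac cont_derive := apply (ex_derive_continuous (V := R_NormedModule)); auto_derive; auto.

Lemma continuous_atan x : continuous atan x.
Proof. apply continuity_pt_filterlim, derivable_continuous_pt, derivable_pt_atan. Qed.

(* The substitutions [y = x t], [x = r / sqrt (1 + t^2)] and [t = tan theta] turn the integral over the
   trapezoid [1 <= x <= b], [|y| <= x] into one over a region containing the sector. *)
Lemma sector_le_square_integral (k : R -> R -> R) b :
  cont2 k -> (forall x y, 0 <= k x y) -> 2 <= b ->
  RInt (fun r => r * RInt (fun t => k (r * cos t) (r * sin t)) (- (PI / 4)) (PI / 4)) 2 b
  <= square_integral k b.
Proof.
  intros Hk H0 Hb.
  assert (Hkxy : cont2 (fun x t => x * k x (x * t))).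
  { apply cont2_mult; [apply cont2_fst; intros; apply continuous_id|].
    apply (cont2_comp k); auto.
    - apply cont2_fst; intros; apply continuous_id.
    - apply cont2_mult; (apply cont2_fst || apply cont2_snd); intros; apply continuous_id. }
  assert (Hinner : forall x, continuous (fun x => RInt (fun y => k x y) (- b) b) x)
    by (intros; now apply RInt_param_continuous).
  apply Rle_trans with (RInt (fun x => RInt (fun t => x * k x (x * t)) (- 1) 1) 1 b).
  2:{ apply Rle_trans with (RInt (fun x => RInt (fun y => k x y) (- b) b) 1 b).
      - apply RInt_le; [lra | | |].
        + apply continuous_ex_RInt. now apply RInt_param_continuous.
        + now apply continuous_ex_RInt.
        + intros x Hx. pose proof (RInt_comp_lin_R (k x) x 0 (-1) 1 (cont2_slice_r _ x Hk)) as E.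
          rewrite (RInt_ext _ (fun t => x * k x (x * t + 0))) by (intros; rewrite Rplus_0_r; reflexivity).
          rewrite E. apply RInt_le_enlarge; [now apply cont2_slice_r | intros; apply H0 | lra..].
      - apply RInt_le_enlarge; auto; try lra. intros x _.
        apply RInt_ge_0; [lra | now apply continuous_ex_RInt, cont2_slice_r | intros; apply H0]. }
  rewrite RInt_fubini by exact Hkxy.
  (* The integrand after [x = r / sqrt (1 + t^2)]. The factor [/ (1 + t ^ 2)] comes from [x dx], and
     it is also the derivative of [atan] needed for [t = tan theta]. *)
  set (w := fun r t => r * (k (r * cos (atan t)) (r * sin (atan t)) * / (1 + t ^ 2))).
  assert (Hsq : forall t, 0 < 1 + t ^ 2) by (intros t; pose proof (pow2_ge_0 t); lra).
  assert (Hki : cont2 (fun r t => k (r * cos (atan t)) (r * sin (atan t)) * / (1 + t ^ 2))).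
  { apply cont2_mult.
    - apply (cont2_comp (fun r t => k (r * cos t) (r * sin t)) (fun r _ => r) (fun _ t => atan t)).
      + now apply cont2_polar.
      + apply cont2_fst; intros; apply continuous_id.
      + apply cont2_snd, continuous_atan.
    - apply (cont2_snd (fun t => / (1 + t ^ 2))). intros t. cont_derive. pose proof (Hsq t). simpl in *. lra. }
  assert (Hw : cont2 w).
  { apply cont2_mult; [apply cont2_fst; intros; apply continuous_id | exact Hki]. }
  apply Rle_trans with (RInt (fun t => RInt (fun r => w r t) 2 b) (- 1) 1).
  - rewrite <- RInt_fubini by exact Hw. right. apply RInt_ext. intros r _.
    unfold w. rewrite RInt_scal_R by now apply (cont2_slice_r _ r Hki). f_equal.
    pose proof (RInt_comp (V := R_CompleteNormedModule) (fun t => k (r * cos t) (r * sin t)) atan (fun t => / (1 + t ^ 2)) (- 1) 1) as E.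
    replace (atan (-1)) with (- (PI / 4)) in E by (rewrite <- atan_1, <- atan_opp; f_equal; lra).
    rewrite atan_1 in E.
    rewrite <- E.
    + apply RInt_ext. intros t _. unfold scal; simpl; unfold mult; simpl. apply Rmult_comm.
    + intros t _. apply (cont2_slice_r _ r (cont2_polar k Hk)).
    + intros t _. split.
      * apply is_derive_Reals, derivable_pt_lim_atan.
      * cont_derive. pose proof (Hsq t). simpl in *. lra.
  - apply RInt_le; [lra | | |].
    + apply continuous_ex_RInt. apply (RInt_param_continuous (fun t r => w r t)). now apply cont2_swap.
    + apply continuous_ex_RInt. apply (RInt_param_continuous (fun t x => x * k x (x * t))). now apply cont2_swap.
    + intros t Ht. set (c := sqrt (1 + t ^ 2)).
      assert (Hc2 : c * c = 1 + t ^ 2) by (apply sqrt_sqrt; left; apply Hsq).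
      assert (Hc0 : 0 < c) by (apply sqrt_lt_R0, Hsq).
      (* Since [|t| <= 1], the range [[c, c b]] of [r] contains [[2, b]]; this is why radii start at
         [2]. *)
      assert (Hc : 1 <= c <= 2) by nra.
      pose proof (RInt_comp_lin_R (fun x => x * k x (x * t)) (/ c) 0 c (c * b) (cont2_slice_l _ t Hkxy)) as E.
      replace (/ c * c + 0) with 1 in E by (field; lra).
      replace (/ c * (c * b) + 0) with b in E by (field; lra).
      rewrite <- E.
      rewrite (RInt_ext (fun y => / c * ((/ c * y + 0) * k (/ c * y + 0) ((/ c * y + 0) * t))) (fun r => w r t)).
      * apply RInt_le_enlarge; [now apply cont2_slice_l | | lra | lra | nra].
        intros r Hr. unfold w. apply Rmult_le_pos; [nra|].
        apply Rmult_le_pos; [apply H0 | left; now apply Rinv_0_lt_compat].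
      * intros r _. unfold w. rewrite cos_atan, sin_atan.
        replace (sqrt (1 + Rsqr t)) with c by (unfold c, Rsqr; do 2 f_equal; ring).
        rewrite <- Hc2.
        replace (/ c * r + 0) with (r * (1 / c)) by (field; lra).
        replace (r * (1 / c) * t) with (r * (t / c)) by (field; lra).
        match goal with |- ?a = ?b => change (@eq R a b) end. field. lra.
Qed.

(** The circle is cut at the odd multiples of [PI / 4], so that the four arcs are quarter turns of
    the one in [sector_le_square_integral]. *)
Lemma RInt_four_quarters (k : R -> R -> R) r : cont2 k ->
  let q (k : R -> R -> R) := RInt (fun t => k (r * cos t) (r * sin t)) (- (PI / 4)) (PI / 4) in
  RInt (fun t => k (r * cos t) (r * sin t)) 0 (2 * PI)
  = q k + q (fun x y => k (- y) x) + q (fun x y => k (- x) (- y)) + q (fun x y => k y (- x)).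
Proof.
  intros Hk q.
  set (G := fun t => k (r * cos t) (r * sin t)).
  assert (HG : forall t, continuous G t) by apply (cont2_slice_r _ r (cont2_polar k Hk)).
  assert (Hi : forall a b, ex_RInt G a b) by (intros; now apply continuous_ex_RInt).
  assert (Hper : forall t, G (t + 2 * PI) = G t).
  { intros t. unfold G. now rewrite cos_plus, sin_plus, cos_2PI, sin_2PI, !Rmult_1_r, !Rmult_0_r, Rminus_0_r, Rplus_0_r. }
  rewrite <- (RInt_periodic G (2 * PI) (- (PI / 4)) HG Hper).
  assert (Hsh : forall c, RInt G (- (PI / 4) + c) (PI / 4 + c) = RInt (fun t => G (t + c)) (- (PI / 4)) (PI / 4)).
  { intros c. pose proof (RInt_comp_lin_R G 1 c (- (PI / 4)) (PI / 4) HG) as E.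
    rewrite !Rmult_1_l in E. rewrite <- E. apply RInt_ext. intros t _. now rewrite !Rmult_1_l. }
  assert (E1 : RInt G (- (PI / 4) + PI / 2) (PI / 4 + PI / 2) = q (fun x y => k (- y) x)).
  { rewrite Hsh. apply RInt_ext. intros t _. unfold G.
    rewrite cos_plus, sin_plus, cos_PI2, sin_PI2. f_equal; ring. }
  assert (E2 : RInt G (- (PI / 4) + PI) (PI / 4 + PI) = q (fun x y => k (- x) (- y))).
  { rewrite Hsh. apply RInt_ext. intros t _. unfold G. rewrite neg_cos, neg_sin. f_equal; ring. }
  assert (E3 : RInt G (- (PI / 4) + (PI / 2 + PI)) (PI / 4 + (PI / 2 + PI)) = q (fun x y => k y (- x))).
  { rewrite Hsh. apply RInt_ext. intros t _. unfold G.
    replace (t + (PI / 2 + PI)) with (t + PI / 2 + PI) by ring. rewrite neg_cos, neg_sin.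
    rewrite cos_plus, sin_plus, cos_PI2, sin_PI2. f_equal; ring. }
  rewrite <- E1, <- E2, <- E3. unfold q. fold G.
  pose proof (RInt_Chasles G (- (PI / 4)) (PI / 4) (PI / 4 + PI / 2) (Hi _ _) (Hi _ _)) as C1.
  pose proof (RInt_Chasles G (- (PI / 4)) (PI / 4 + PI / 2) (PI / 4 + PI) (Hi _ _) (Hi _ _)) as C2.
  pose proof (RInt_Chasles G (- (PI / 4)) (PI / 4 + PI) (PI / 4 + (PI / 2 + PI)) (Hi _ _) (Hi _ _)) as C3.
  replace (- (PI / 4) + PI / 2) with (PI / 4) by field.
  replace (- (PI / 4) + PI) with (PI / 4 + PI / 2) by field.
  replace (- (PI / 4) + (PI / 2 + PI)) with (PI / 4 + PI) by field.
  replace (- (PI / 4) + 2 * PI) with (PI / 4 + (PI / 2 + PI)) by field.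
  unfold plus in *; simpl in *. change (fun t => k (r * cos t) (r * sin t)) with G. lra.
Qed.

(** Each quarter sector is bounded by the whole square, which quarter turns preserve. The factor 4
    is harmless, as only a bound uniform in [b] is wanted. *)
Lemma polar_le_square_integral (k : R -> R -> R) b :
  cont2 k -> (forall x y, 0 <= k x y) -> 2 <= b ->
  RInt (fun r => r * RInt (fun t => k (r * cos t) (r * sin t)) 0 (2 * PI)) 2 b
  <= 4 * square_integral k b.
Proof.
  intros Hk H0 Hb.
  assert (Hopp : cont2 (fun x _ => - x) /\ cont2 (fun _ y => - y)).
  { split; [apply (cont2_fst (fun x => - x)) | apply (cont2_snd (fun x => - x))]; intros x; cont_derive. }
  assert (Hid : cont2 (fun x _ => x) /\ cont2 (fun _ y => y)).
  { split; [apply (cont2_fst (fun x => x)) | apply (cont2_snd (fun x => x))]; intros x; apply continuous_id. }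
  destruct Hopp as [Ho1 Ho2], Hid as [Hi1 Hi2].
  set (k1 := fun x y => k (- y) x). set (k2 := fun x y => k (- x) (- y)). set (k3 := fun x y => k y (- x)).
  assert (Hk1 : cont2 k1) by now apply (cont2_comp k).
  assert (Hk2 : cont2 k2) by now apply (cont2_comp k).
  assert (Hk3 : cont2 k3) by now apply (cont2_comp k).
  set (A := fun (k : R -> R -> R) r => r * RInt (fun t => k (r * cos t) (r * sin t)) (- (PI / 4)) (PI / 4)).
  assert (HA : forall k, cont2 k -> forall r, continuous (A k) r).
  { intros h Hh r. apply (continuous_mult (K := R_AbsRing)); [apply continuous_id|].
    apply (RInt_param_continuous (fun r t => h (r * cos t) (r * sin t))). now apply cont2_polar. }
  assert (HAi : forall k, cont2 k -> ex_RInt (A k) 2 b) by (intros; apply continuous_ex_RInt; now apply HA).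
  assert (E : RInt (fun r => r * RInt (fun t => k (r * cos t) (r * sin t)) 0 (2 * PI)) 2 b
    = RInt (A k) 2 b + RInt (A k1) 2 b + RInt (A k2) 2 b + RInt (A k3) 2 b).
  { rewrite (RInt_ext _ (fun r => (A k r + A k1 r) + (A k2 r + A k3 r))).
    - transitivity (RInt (fun r => A k r + A k1 r) 2 b + RInt (fun r => A k2 r + A k3 r) 2 b).
      + apply (@RInt_plus R_CompleteNormedModule (fun r => A k r + A k1 r) (fun r => A k2 r + A k3 r));
          apply (@ex_RInt_plus R_NormedModule); now apply HAi.
      + rewrite Rplus_assoc. f_equal;
          apply (@RInt_plus R_CompleteNormedModule); now apply HAi.
    - intros r _. rewrite (RInt_four_quarters k r Hk). unfold A, k1, k2, k3. cbv beta zeta.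
      match goal with |- ?a = ?b => change (@eq R a b) end. ring. }
  assert (S1 : square_integral k1 b = square_integral k b) by now apply square_integral_rot.
  assert (S2 : square_integral k2 b = square_integral k1 b).
  { rewrite <- (square_integral_rot k1 b Hk1). reflexivity. }
  assert (S3 : square_integral k3 b = square_integral k2 b).
  { rewrite <- (square_integral_rot k2 b Hk2). unfold k2, k3, square_integral.
    apply RInt_ext. intros x _. apply RInt_ext. intros y _. now rewrite Ropp_involutive. }
  pose proof (sector_le_square_integral k b Hk H0 Hb).
  pose proof (sector_le_square_integral k1 b Hk1 (fun x y => H0 _ _) Hb).
  pose proof (sector_le_square_integral k2 b Hk2 (fun x y => H0 _ _) Hb).
  pose proof (sector_le_square_integral k3 b Hk3 (fun x y => H0 _ _) Hb).
  rewrite E. unfold A. lra.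
Qed.

(** * Decay of the weighted means *)

Lemma is_derive_pos_left_lt (D : R -> R) x d a : is_derive D x d -> 0 < d -> a < x ->
  exists y, a < y < x /\ D y < D x.
Proof.
  intros HD Hd Ha. apply is_derive_Reals in HD.
  destruct (HD (d / 2) ltac:(lra)) as [delta Hdelta].
  set (h := Rmin (delta / 2) ((x - a) / 2)).
  pose proof (cond_pos delta) as Hdp.
  assert (Hh : 0 < h) by (apply Rmin_pos; lra).
  assert (Hh1 : h <= delta / 2) by apply Rmin_l. assert (Hh2 : h <= (x - a) / 2) by apply Rmin_r.
  specialize (Hdelta (- h) ltac:(lra) ltac:(rewrite Rabs_Ropp, Rabs_pos_eq; lra)).
  exists (x + - h). split; [lra|].
  apply Rabs_def2 in Hdelta. destruct Hdelta as [_ H].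
  assert (Hq : d / 2 < (D (x + - h) - D x) / - h) by lra.
  assert (E : D (x + - h) - D x = - h * ((D (x + - h) - D x) / - h)) by (field; lra).
  nra.
Qed.

(** [A] is taken so that the integral up to [A] is within [eps] of the supremum of all integrals
    from [2]. *)
Lemma bounded_integral_tail (u : R -> R) K :
  (forall x, continuous u x) -> (forall x, 0 <= x -> 0 <= u x) ->
  (forall b, 2 <= b -> RInt u 2 b <= K) ->
  forall eps, 0 < eps -> exists A, 2 <= A /\ forall a b, A <= a -> a <= b -> RInt u a b <= eps.
Proof.
  intros Hc H0 HK eps Heps.
  destruct (completeness (fun v => exists b, 2 <= b /\ v = RInt u 2 b)) as [M [HM1 HM2]].
  - exists K. intros v (b & Hb & ->). now apply HK.
  - exists (RInt u 2 2), 2. split; [lra | reflexivity].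
  - destruct (classic (exists A, 2 <= A /\ M - eps < RInt u 2 A)) as [(A & HA & H) | Hn].
    + exists A. split; auto. intros a b Ha Hab.
      apply Rle_trans with (RInt u A b).
      * apply RInt_le_enlarge; auto; try lra. intros; apply H0; lra.
      * assert (Hi : forall a b, ex_RInt u a b) by (intros; now apply continuous_ex_RInt).
        pose proof (RInt_Chasles u 2 A b (Hi _ _) (Hi _ _)) as E. unfold plus in E; simpl in E.
        assert (RInt u 2 b <= M) by (apply HM1; exists b; split; [lra | reflexivity]). lra.
    + exfalso. assert (M <= M - eps); [|lra]. apply HM2. intros v (b & Hb & ->).
      apply Rnot_lt_le. intros H. apply Hn. exists b. auto.
Qed.

(** Otherwise [u] exceeds [eps] beyond [A], and over a length [2 / eps] its integral reaches [2]. *)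
Lemma small_value_of_small_integral (u : R -> R) A eps :
  (forall x, continuous u x) -> 0 < eps ->
  (forall b, A <= b -> RInt u A b <= 1) -> exists a, A <= a /\ u a <= eps.
Proof.
  intros Hc Heps H1.
  destruct (classic (exists a, A <= a /\ u a <= eps)) as [|Hn]; [auto | exfalso].
  assert (H2 : 0 < 2 / eps) by (apply Rdiv_lt_0_compat; lra).
  assert (RInt (fun _ => eps) A (A + 2 / eps) <= RInt u A (A + 2 / eps)).
  { apply RInt_le; [lra | apply ex_RInt_const | now apply continuous_ex_RInt |].
    intros x Hx. left. apply Rnot_le_lt. intros H. apply Hn. exists x. split; [lra | auto]. }
  rewrite RInt_const in H. unfold scal in H; simpl in H; unfold mult in H; simpl in H.
  replace ((A + 2 / eps - A) * eps) with 2 in H by (field; lra).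
  specialize (H1 (A + 2 / eps) ltac:(lra)). lra.
Qed.

Section Decay.
Variables (lam phi u : R -> R) (s X K : R).
Hypothesis lam_pos : forall x, 0 <= x -> 0 < lam x.
Hypothesis lam_der : forall x, 0 <= x -> ex_derive lam x.
Hypothesis phi_ge_0 : forall x, 0 <= phi x.
Hypothesis phi_max : forall beta x y z, 0 < x -> x <= y -> y <= z ->
  Rpower y beta * phi y <= Rmax (Rpower x beta * phi x) (Rpower z beta * phi z).
Hypothesis u_cont : forall x, continuous u x.
Hypothesis u_eq : forall x, 0 <= x -> u x = x ^ 3 * phi x / lam x.
Hypothesis s_pos : 0 < s.

(** The lower bound on [S_fun] is used through partial integrals of this integrand, which also
    covers an infinite [S_fun]. *)
Let S_integrand x0 x := lam x0 / lam x * rpow (x / x0) (x0 * Derive lam x0 / lam x0).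

Hypothesis S_large : forall x0, X <= x0 -> exists b, x0 <= b /\ s < RInt (S_integrand x0) x0 b.
Hypothesis u_int : forall b, 2 <= b -> RInt u 2 b <= K.

Let u_ge_0 x : 0 <= x -> 0 <= u x.
Proof.
  intros Hx. rewrite u_eq by auto.
  apply Rdiv_le_0_compat; [apply Rmult_le_pos; [now apply pow_le | auto] | now apply lam_pos].
Qed.

Let h x := x ^ 3 * phi x.

Lemma S_integrand_ex_RInt x0 b : 0 < x0 -> x0 <= b -> ex_RInt (S_integrand x0) x0 b.
Proof.
  intros H0 Hb. apply (@ex_RInt_continuous R_CompleteNormedModule). intros x Hx.
  rewrite Rmin_left, Rmax_right in Hx by lra.
  apply (continuous_mult (K := R_AbsRing) (fun x => lam x0 / lam x)).
  - apply (continuous_mult (K := R_AbsRing) (fun _ => lam x0) (fun x => / lam x)); [apply continuous_const|].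
    apply (ex_derive_continuous (V := R_NormedModule)). apply ex_derive_inv; [apply lam_der; lra|].
    apply Rgt_not_eq, lam_pos; lra.
  - apply continuous_ext_loc with (fun y => Rpower (y / x0) (x0 * Derive lam x0 / lam x0)).
    + apply (filter_imp (fun y => 0 < y)); [|apply open_gt; lra].
      intros y Hy. rewrite rpow_pos; [reflexivity | now apply Rdiv_lt_0_compat].
    + apply (continuous_comp (fun y => y / x0) (fun y => Rpower y (x0 * Derive lam x0 / lam x0))).
      * apply (ex_derive_continuous (V := R_NormedModule)). auto_derive. auto.
      * apply continuous_Rpower_base. apply Rdiv_lt_0_compat; lra.
Qed.

(* If [h] were below its tangent power at [x], then so would it be for a smaller exponent [k'];
   the maximum principle would then make [lam y * y ^ (-k')] minimal at [x0] from the left,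
   although its derivative there is positive. *)
Lemma tangent_power_le a x0 x : 0 <= a < x0 -> x0 <= x ->
  (forall y, a <= y <= x0 -> u y <= u x0) ->
  h x0 * rpow (x / x0) (x0 * Derive lam x0 / lam x0) <= h x.
Proof.
  intros Ha Hx Hmax.
  set (k := x0 * Derive lam x0 / lam x0).
  assert (Hlam0 : 0 < lam x0) by (apply lam_pos; lra).
  assert (Hge : forall y, 0 <= y -> 0 <= h y)
    by (intros; apply Rmult_le_pos; [now apply pow_le | auto]).
  assert (Hx1 : 1 <= x / x0) by (apply Rmult_le_reg_r with x0; [lra|]; field_simplify; lra).
  rewrite rpow_pos by lra.
  destruct Hx as [Hx | <-].
  2:{ unfold Rdiv. rewrite Rinv_r by lra. unfold Rpower. rewrite ln_1, Rmult_0_r, exp_0. lra. }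
  apply Rnot_lt_le. intros Hlt.
  assert (Hh0 : 0 < h x0).
  { destruct (Hge x0) as [|E]; [lra | auto|]. rewrite <- E, Rmult_0_l in Hlt.
    pose proof (Hge x ltac:(lra)). lra. }
  set (L := ln (x / x0)).
  assert (HL : 0 < L).
  { unfold L. rewrite <- ln_1. apply ln_increasing; [lra|].
    apply Rmult_lt_reg_r with x0; [lra|]. unfold Rdiv. rewrite Rmult_assoc, Rinv_l; lra. }
  (* The midpoint is positive even if [h x = 0], so [ln q] makes sense, and it lies strictly between
     the growth of [h] and that of the tangent power. *)
  set (q := (h x / h x0 + exp (k * L)) / 2).
  assert (Hq1 : h x / h x0 < exp (k * L)).
  { apply Rmult_lt_reg_r with (h x0); [auto|]. unfold Rpower in Hlt. fold L in Hlt.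
    unfold Rdiv. rewrite Rmult_assoc, Rinv_l; lra. }
  assert (Hq0 : 0 <= h x / h x0) by (apply Rdiv_le_0_compat; [apply Hge; lra | auto]).
  assert (Hq : 0 < q < exp (k * L)) by (unfold q; lra).
  set (k' := ln q / L).
  assert (Ek' : k' * L = ln q) by (unfold k'; field; lra).
  assert (Hk' : k' < k).
  { apply Rmult_lt_reg_r with L; auto. rewrite Ek', <- (ln_exp (k * L)). now apply ln_increasing. }
  assert (Hkx : h x < h x0 * exp (k' * L)).
  { rewrite Ek', exp_ln by lra.
    replace (h x) with (h x0 * (h x / h x0)) by (field; lra).
    apply Rmult_lt_compat_l; [auto|]. unfold q; lra. }
  assert (Hpow : forall y, 0 < y -> Rpower y (3 - k') * phi y = h y * Rpower y (- k')).
  { intros y Hy. unfold h. replace (3 - k') with (INR 3 + - k') by (simpl; ring).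
    rewrite Rpower_plus, Rpower_pow by auto. ring. }
  assert (HHx : Rpower x (3 - k') * phi x < Rpower x0 (3 - k') * phi x0).
  { rewrite !Hpow by lra.
    assert (E : Rpower x0 (- k') = exp (k' * L) * Rpower x (- k')).
    { unfold Rpower, L. rewrite <- exp_plus, ln_div by lra. f_equal. ring. }
    rewrite E. pose proof (exp_pos (- k' * ln x)) as Hp. change (0 < Rpower x (- k')) in Hp. nra. }
  (* With exponent [3 - k'] the value at [x] is below the one at [x0], so in the maximum principle
     on [[y, x]] the end [y] must dominate; [u y <= u x0] then trades [h] for [lam]. *)
  assert (HD : forall y, a < y < x0 -> lam x0 * Rpower x0 (- k') <= lam y * Rpower y (- k')).
  { intros y Hy.
    pose proof (phi_max (3 - k') y x0 x ltac:(lra) ltac:(lra) ltac:(lra)) as Hm.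
    assert (Hm' : Rpower x0 (3 - k') * phi x0 <= Rpower y (3 - k') * phi y).
    { apply Rnot_lt_le. intros Hc. revert Hm. apply Rlt_not_le. now apply Rmax_lub_lt. }
    rewrite !Hpow in Hm' by lra.
    specialize (Hmax y ltac:(lra)). rewrite !u_eq in Hmax by lra. fold (h y) in Hmax. fold (h x0) in Hmax.
    assert (Hly : 0 < lam y) by (apply lam_pos; lra).
    assert (Hhy : h y * lam x0 <= h x0 * lam y).
    { apply Rmult_le_compat_r with (r := lam y * lam x0) in Hmax; [|nra].
      replace (h y / lam y * (lam y * lam x0)) with (h y * lam x0) in Hmax by (field; lra).
      replace (h x0 / lam x0 * (lam y * lam x0)) with (h x0 * lam y) in Hmax by (field; lra).
      exact Hmax. }
    pose proof (exp_pos (- k' * ln y)) as Hp. change (0 < Rpower y (- k')) in Hp.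
    apply Rmult_le_reg_l with (h x0); [auto|].
    apply Rle_trans with (h y * Rpower y (- k') * lam x0); nra. }
  destruct (is_derive_pos_left_lt (fun y => lam y * Rpower y (- k')) x0
    (Derive lam x0 * Rpower x0 (- k') + lam x0 * (- k' * Rpower x0 (- k' - 1))) a) as (y & Hy & Hlt').
  - apply (is_derive_mult (K := R_AbsRing) lam (fun y => Rpower y (- k'))).
    + apply Derive_correct, lam_der. lra.
    + apply is_derive_Reals, derivable_pt_lim_power. lra.
    + intros; apply Rmult_comm.
  - replace (- k' - 1) with (- k' + - (1)) by ring.
    rewrite Rpower_plus, (Rpower_Ropp x0 1), Rpower_1 by lra.
    pose proof (exp_pos (- k' * ln x0)) as Hp. change (0 < Rpower x0 (- k')) in Hp.
    (* The derivative is a positive multiple of [k - k']. *)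
    replace (Derive lam x0 * Rpower x0 (- k') + lam x0 * (- k' * (Rpower x0 (- k') * / x0)))
      with (Rpower x0 (- k') * (lam x0 / x0) * (k - k')) by (unfold k; field; lra).
    apply Rmult_lt_0_compat; [|lra]. apply Rmult_lt_0_compat; [auto|]. apply Rdiv_lt_0_compat; lra.
  - lra.
  - specialize (HD y Hy). lra.
Qed.

Lemma left_max_le_tail a x0 tail : 0 <= a < x0 -> X <= x0 ->
  (forall y, a <= y <= x0 -> u y <= u x0) ->
  (forall b, x0 <= b -> RInt u x0 b <= tail) -> u x0 * s <= tail.
Proof.
  intros Ha HX Hmax Htail.
  destruct (S_large x0 HX) as (b & Hb & Hs).
  assert (Hu0 : 0 <= u x0) by (apply u_ge_0; lra).
  apply Rle_trans with (u x0 * RInt (S_integrand x0) x0 b); [apply Rmult_le_compat_l; lra|].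
  apply Rle_trans with (RInt u x0 b); [|now apply Htail].
  assert (Hi := S_integrand_ex_RInt x0 b ltac:(lra) Hb).
  assert (E : u x0 * RInt (S_integrand x0) x0 b = RInt (fun x => u x0 * S_integrand x0 x) x0 b).
  { symmetry. now apply (@RInt_scal R_CompleteNormedModule (S_integrand x0)). }
  rewrite E. apply RInt_le; [lra | | now apply continuous_ex_RInt |].
  - now apply (@ex_RInt_scal R_NormedModule (S_integrand x0)).
  - intros x Hx. pose proof (tangent_power_le a x0 x Ha ltac:(lra) Hmax) as HT.
    assert (Hl0 : 0 < lam x0) by (apply lam_pos; lra). assert (Hl : 0 < lam x) by (apply lam_pos; lra).
    rewrite !u_eq by lra. fold (h x). fold (h x0). unfold S_integrand.
    set (e := rpow _ _) in *.
    replace (h x0 / lam x0 * (lam x0 / lam x * e)) with (h x0 * e * / lam x) by (field; lra).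
    apply Rmult_le_compat_r; [left; now apply Rinv_0_lt_compat | exact HT].
Qed.

Theorem weighted_mean_vanishes eps : 0 < eps -> exists A, 0 <= A /\ forall x, A <= x -> u x <= eps.
Proof.
  intros Heps.
  (* The bound [1] serves to find the starting point [a]; the bound [eps * s] becomes [u m <= eps]
     after division by [s]. *)
  destruct (bounded_integral_tail u K u_cont u_ge_0 u_int (Rmin 1 (eps * s))) as (A & HA & Htail).
  { apply Rmin_pos; [lra | nra]. }
  destruct (small_value_of_small_integral u (Rmax A X) eps u_cont Heps) as (a & Ha & Hua).
  { intros b Hb. eapply Rle_trans; [apply Htail; [apply Rmax_l | auto] | apply Rmin_l]. }
  pose proof (Rmax_l A X). pose proof (Rmax_r A X).
  exists a. split; [lra|]. intros x Hx.
  destruct (continuity_ab_maj u a x Hx) as (m & Hm & Hmx).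
  { intros c _. apply continuity_pt_filterlim, u_cont. }
  apply Rle_trans with (u m); [apply Hm; lra|].
  destruct (Req_dec m a) as [-> | Hne]; [auto|].
  apply Rmult_le_reg_r with s; [auto|].
  apply (left_max_le_tail a m (eps * s)); [lra | lra | intros; apply Hm; lra|].
  intros b Hb. eapply Rle_trans; [apply Htail; lra | apply Rmin_r].
Qed.
End Decay.

(** * Limits and lower limits in explicit form, trigonometric uniqueness *)

Lemma continuous_eps_delta (f : R -> R) : (forall x, continuous f x) ->
  forall x e, 0 < e -> exists d, 0 < d /\ forall y, Rabs (y - x) < d -> Rabs (f y - f x) < e.
Proof.
  intros Hf x e He.
  assert (H : continuity_pt f x) by apply continuity_pt_filterlim, Hf.
  destruct (proj1 (continuity_pt_locally f x) H (mkposreal e He)) as [d Hd].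
  exists d. split; [apply cond_pos | exact Hd].
Qed.

Lemma RInt_derivative_eps_delta (f : R -> R) a : (forall x, continuous f x) ->
  forall x e, 0 < e -> exists d, 0 < d /\ forall h, h <> 0 -> Rabs h < d ->
    Rabs ((RInt f a (x + h) - RInt f a x) / h - f x) < e.
Proof.
  intros Hf x e He.
  assert (H : is_derive (fun x => RInt f a x) x (f x)).
  { apply (@is_derive_RInt R_CompleteNormedModule f _ a); [|apply Hf].
    apply filter_forall. intros y. now apply (@RInt_correct R_CompleteNormedModule), continuous_ex_RInt. }
  apply is_derive_Reals in H. destruct (H e He) as [d Hd].
  exists d. split; [apply cond_pos | exact Hd].
Qed.

Lemma liminf_pinfty_pos (g : R -> Rbar) : Rbar_lt 0 (liminf_pinfty g) ->
  exists s X : R, 0 < s /\ forall x, X <= x -> Rbar_lt s (g x).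
Proof.
  intros H. unfold liminf_pinfty in H.
  set (E := fun m => exists X : R, m = Rbar_glb (fun y => exists x, X <= x /\ y = g x)) in H.
  assert (Hm : exists m, E m /\ Rbar_lt 0 m).
  { apply NNPP. intros Hn. apply (Rbar_lt_not_le _ _ H).
    apply (proj2 (proj2_sig (Rbar_ex_lub E))). intros m Hm. apply Rbar_not_lt_le. intros Hc. apply Hn. now exists m. }
  destruct Hm as (m & [X ->] & Hm).
  set (m := Rbar_glb _) in Hm.
  assert (Hs : exists s : R, 0 < s /\ Rbar_lt s m).
  { destruct m as [m | |]; simpl in Hm.
    - exists (m / 2). simpl. lra.
    - exists 1. split; [lra | exact I].
    - contradiction. }
  destruct Hs as (s & Hs & Hsm). exists s, X. split; auto. intros x Hx.
  eapply Rbar_lt_le_trans; [exact Hsm|].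
  apply (proj1 (proj2_sig (Rbar_ex_glb (fun y => exists x, X <= x /\ y = g x)))). now exists x.
Qed.

(** [Lim F p_infty] is computed along the sequence [F (INR n)], and a function staying below [s]
    from [x0] on would give a value at most [s]. *)
Lemma Lim_pinfty_gt (F : R -> R) (s x0 : R) : Rbar_lt s (Lim F p_infty) ->
  exists b, x0 <= b /\ s < F b.
Proof.
  intros H. apply NNPP. intros Hn. apply (Rbar_lt_not_le _ _ H).
  unfold Lim. rewrite <- (Lim_seq_const s). apply Lim_seq_le_loc.
  destruct (INR_unbounded x0) as [N HN]. exists N. intros n Hnn. simpl.
  apply Rnot_lt_le. intros Hc. apply Hn. exists (INR n). split; auto.
  apply le_INR in Hnn. lra.
Qed.

Lemma lam_of_inv (w : R -> R) x : 0 < lam_of w x -> - Derive w (x ^ 2) = / lam_of w x.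
Proof.
  unfold lam_of. intros H. destruct (Req_dec (Derive w (x ^ 2)) 0) as [E | Hne].
  (* The inverse of [0] is [0], so a vanishing derivative would make [lam_of w x] zero, against its
     positivity. *)
  - rewrite E in H. unfold Rdiv in H. rewrite Rinv_0 in H. lra.
  - field. auto.
Qed.

Lemma rpow_rpow_inv x p : 0 < p -> 0 <= x -> rpow (rpow x (1 / p)) p = x.
Proof.
  intros Hp [Hx | <-].
  - rewrite (rpow_pos x) by auto. rewrite rpow_pos by apply exp_pos. rewrite Rpower_mult.
    replace (1 / p * p) with 1 by (field; lra). now apply Rpower_1.
  - rewrite (rpow_nonpos 0) by lra. now rewrite rpow_nonpos by lra.
Qed.

(** The squared distance between [(c, s)] and [(cos, sin)] has derivative zero and vanishes at [0].
    It serves to identify two definitions of the trigonometric functions. *)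
Lemma cos_sin_unique (c s : R -> R) :
  (forall x, derivable_pt_lim c x (- s x)) -> (forall x, derivable_pt_lim s x (c x)) ->
  c 0 = 1 -> s 0 = 0 -> forall x, c x = cos x /\ s x = sin x.
Proof.
  intros Hc Hs Hc0 Hs0.
  set (E := fun x => (c x - cos x) * (c x - cos x) + (s x - sin x) * (s x - sin x)).
  assert (HE : forall x, is_derive E x 0).
  { intros x. specialize (Hc x). specialize (Hs x). apply is_derive_Reals in Hc. apply is_derive_Reals in Hs.
    unfold E. auto_derive.
    - repeat split; eexists; eassumption.
    - apply is_derive_unique in Hc. apply is_derive_unique in Hs.
      change (Derive (fun x => c x) x) with (Derive c x). change (Derive (fun x => s x) x) with (Derive s x).
      rewrite Hc, Hs. ring. }
  assert (HE0 : forall x, E x = 0).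
  { assert (E0 : E 0 = 0) by (unfold E; rewrite Hc0, Hs0, cos_0, sin_0; ring).
    intros x. destruct (Rtotal_order x 0) as [Hx | [-> | Hx]]; auto.
    - rewrite (eq_is_derive (V := R_NormedModule) E x 0); auto.
    - rewrite <- (eq_is_derive (V := R_NormedModule) E 0 x); auto. }
  intros x. specialize (HE0 x). unfold E in HE0.
  pose proof (Rle_0_sqr (c x - cos x)) as H1. pose proof (Rle_0_sqr (s x - sin x)) as H2. unfold Rsqr in *.
  assert (c x - cos x = 0) by (apply Rsqr_0_uniq; unfold Rsqr; lra).
  assert (s x - sin x = 0) by (apply Rsqr_0_uniq; unfold Rsqr; lra). lra.
Qed.

Lemma Cmod_polar r t : 0 <= r -> Cmod (r * cos t, r * sin t) = r.
Proof.
  intros Hr. unfold Cmod; simpl.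
  pose proof (sin2_cos2 t) as H. unfold Rsqr in H.
  replace (r * cos t * (r * cos t * 1) + r * sin t * (r * sin t * 1)) with (Rsqr r).
  - now apply sqrt_Rsqr.
  - unfold Rsqr. transitivity (r * r * (sin t * sin t + cos t * cos t)); [rewrite H; ring | ring].
Qed.

(** [entire] uses the target structure [C_NormedModule], [holomorphic] that of [C_AbsRing] over
    itself; the norm is [Cmod] in both, so the same estimate serves. *)
Lemma entire_holomorphic (f : C -> C) : entire f -> holomorphic f.
Proof.
  intros Hf z. destruct (Hf z) as [l Hl]. exists l. apply is_Cderive_eps. intros eps Heps.
  destruct Hl as [_ Hl]. destruct (Hl z (fun P HP => HP) (mkposreal eps Heps)) as [d Hd].
  exists d. split; [apply cond_pos|]. intros y Hy. exact (Hd y Hy).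
Qed.

(** * The integrand of the area integral and its circular means *)

Definition density (p : R) (f : C -> C) (w : R -> R) (z : C) : R :=
  - (Cmod z ^ 2 * rpow (Cmod (f z)) p * Derive w (Cmod z ^ 2)).

Section Density.
Variables (p : R) (f : C -> C) (w : R -> R).
Hypothesis Hp : 1 < p.
Hypothesis Hf : entire f.
Hypothesis lam_pos : forall x, 0 <= x -> 0 < lam_of w x.
Hypothesis lam_der : forall x, 0 <= x -> ex_derive (lam_of w) x.

Let density_eq z : density p f w z = Cmod z * Cmod z * rpow (Cmod (f z)) p * / lam_of w (Cmod z).
Proof.
  rewrite <- lam_of_inv by apply lam_pos, Cmod_ge_0. unfold density. ring.
Qed.

Lemma density_ge_0 z : 0 <= density p f w z.
Proof.
  rewrite density_eq. pose proof (Cmod_ge_0 z). pose proof (rpow_ge_0 (Cmod (f z)) p).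
  apply Rmult_le_pos; [apply Rmult_le_pos; [nra | auto] | left; now apply Rinv_0_lt_compat, lam_pos].
Qed.

(** Written with [lam_of], the weight is evaluated only at the nonnegative number [Cmod z], so the
    hypotheses on the half-line give continuity in the whole plane. *)
Lemma density_cont2 : cont2 (fun x y => density p f w (x, y)).
Proof.
  assert (HC : cont2 (fun x y => Cmod (x, y))).
  { apply (Cmod_continuous (fun z => z)); simpl;
      [apply (cont2_fst (fun x => x)) | apply (cont2_snd (fun x => x))]; intros; apply continuous_id. }
  apply (cont2_ext (fun x y => Cmod (x, y) * Cmod (x, y) * rpow (Cmod (f (x, y))) p * / lam_of w (Cmod (x, y)))).
  { intros; symmetry; apply density_eq. }
  apply cont2_mult; [apply cont2_mult; [now apply cont2_mult|]|].
  - apply cont2_rpow_Cmod; [lra | now apply entire_holomorphic].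
  - apply (cont2_comp1 (fun x => / lam_of w x) (fun x y => Cmod (x, y))); [|exact HC].
    intros x y. apply (ex_derive_continuous (V := R_NormedModule)). apply ex_derive_inv.
    + apply lam_der, Cmod_ge_0.
    + apply Rgt_not_eq, lam_pos, Cmod_ge_0.
Qed.

Lemma density_polar r : 0 <= r ->
  r * RInt (fun t => density p f w (r * cos t, r * sin t)) 0 (2 * PI)
  = r ^ 3 * mean_pow f p r / lam_of w r.
Proof.
  intros Hr. unfold mean_pow.
  rewrite (RInt_ext _ (fun t => (r * r / lam_of w r) * rpow (Cmod (f (r * cos t, r * sin t))) p)).
  - rewrite RInt_scal_R.
    + unfold Rdiv. ring.
    + apply (cont2_slice_r (fun r t => rpow (Cmod (f (r * cos t, r * sin t))) p) r).
      apply (cont2_polar (fun x y => rpow (Cmod (f (x, y))) p)).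
      apply cont2_rpow_Cmod; [lra | now apply entire_holomorphic].
  - intros t _. rewrite density_eq, Cmod_polar by auto. unfold Rdiv.
    match goal with |- ?a = ?b => change (@eq R a b) end. ring.
Qed.

Theorem weighted_mean_is_lim_0 K :
  (forall x, 0 <= x -> 0 < w x) ->
  Rbar_lt 0 (liminf_pinfty (fun x => S_fun x (lam_of w))) ->
  (exists C0 : R, 0 < C0 /\ exists R0 : R, forall r, R0 <= r -> - Derive w r >= C0 * w r) ->
  (forall b, 2 <= b -> square_integral (fun x y => density p f w (x, y)) b <= K) ->
  is_lim (fun r => r ^ 3 * mean_pow f p r * w (r ^ 2)) p_infty 0.
Proof.
  intros w_pos HS (C0 & HC0 & R0 & HR0) HK.
  pose proof (entire_holomorphic f Hf) as Hol.
  set (k := fun x y => density p f w (x, y)) in *.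
  (* In this form [u] is continuous on the whole line; the quotient by [lam_of w r] is controlled
     only for [r >= 0]. *)
  set (u := fun r => r * RInt (fun t => k (r * cos t) (r * sin t)) 0 (2 * PI)).
  destruct (liminf_pinfty_pos _ HS) as (s & X & Hs & HX).
  assert (Hu : forall eps, 0 < eps -> exists A, 0 <= A /\ forall x, A <= x -> u x <= eps).
  { intros eps Heps. apply (weighted_mean_vanishes (lam_of w) (mean_pow f p) u s X (4 * K)); auto.
    - intros x. apply mean_pow_ge_0; [lra | auto].
    - intros beta x y z. apply mean_pow_max_principle; [lra | auto].
    - intros x. apply (continuous_mult (K := R_AbsRing)); [apply continuous_id|].
      apply (RInt_param_continuous (fun r t => k (r * cos t) (r * sin t))).
      apply cont2_polar, density_cont2.
    - intros x Hx. now apply density_polar.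
    - intros x0 Hx0. now apply Lim_pinfty_gt, HX.
    - intros b Hb. eapply Rle_trans; [apply (polar_le_square_integral k b)|].
      + apply density_cont2.
      + intros; apply density_ge_0.
      + exact Hb.
      + apply Rmult_le_compat_l; [lra | now apply HK]. }
  apply is_lim_spec. intros eps. simpl.
  destruct (Hu (eps * C0 / 2)) as (A & HA & HuA).
  { pose proof (cond_pos eps). apply Rdiv_lt_0_compat; [nra | lra]. }
  (* [r >= 1] gives [r ^ 2 >= r >= R0], so the bound on [w] applies at [r ^ 2]. *)
  exists (Rmax A (Rmax 1 R0)). intros r Hr.
  change (Rabs (r ^ 3 * mean_pow f p r * w (r ^ 2) - 0) < eps).
  pose proof (Rmax_l A (Rmax 1 R0)). pose proof (Rmax_r A (Rmax 1 R0)).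
  pose proof (Rmax_l 1 R0). pose proof (Rmax_r 1 R0).
  assert (Hm : 0 <= mean_pow f p r) by (apply mean_pow_ge_0; [lra | auto]).
  specialize (HuA r ltac:(lra)).
  assert (Eu : u r = r ^ 3 * mean_pow f p r / lam_of w r) by (apply density_polar; lra).
  specialize (HR0 (r ^ 2) ltac:(nra)). rewrite lam_of_inv in HR0 by (apply lam_pos; lra).
  specialize (w_pos (r ^ 2) ltac:(nra)).
  assert (Hr3 : 0 <= r ^ 3 * mean_pow f p r) by (apply Rmult_le_pos; [apply pow_le; lra | auto]).
  rewrite Rminus_0_r, Rabs_pos_eq by (apply Rmult_le_pos; lra).
  assert (r ^ 3 * mean_pow f p r * (C0 * w (r ^ 2)) <= eps * C0 / 2).
  { eapply Rle_trans; [|exact HuA]. rewrite Eu. unfold Rdiv. apply Rmult_le_compat_l; lra. }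
  pose proof (cond_pos eps). nra.
Qed.
End Density.

From mathcomp Require Import all_boot all_order all_algebra all_classical all_reals all_analysis.
From mathcomp Require Import measurable_realfun Rstruct Rstruct_topology.
Import Order.TTheory GRing.Theory Num.Theory.
Import numFieldNormedType.Exports.
Local Open Scope classical_set_scope.
Local Open Scope ring_scope.

(** * Riemann and Lebesgue integrals *)

Section IteratedIntegral.
Variable T : realType.

(** Bare epsilon-delta statements are the common ground between the two theories of limits on the
    reals; compare [derivative_eps]. *)
Definition continuous_eps (f : T -> T) : Prop := forall x e, 0 < e ->
  exists2 d, 0 < d & forall y, `|y - x| < d -> `|f y - f x| < e.

Definition derivative_eps (F f : T -> T) : Prop := forall x e, 0 < e ->
  exists2 d, 0 < d & forall h, h != 0 -> `|h| < d -> `|(F (x + h) - F x) / h - f x| < e.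

Lemma continuous_eps_continuous (f : T -> T) : continuous_eps f -> continuous f.
Proof.
move=> cf x; apply/cvgrPdist_lt => e e0.
have [d d0 dP] := cf x e e0.
near=> y; rewrite distrC; apply: dP; rewrite distrC.
by near: y; exact: cvgr_dist_lt.
Unshelve. all: by end_near.
Qed.

Lemma derivative_eps_is_derive (F f : T -> T) (x : T) :
  derivative_eps F f -> is_derive x (1 : T) F (f x).
Proof.
move=> dF.
have H : (fun h : T => h^-1 *: ((F \o shift x) (h *: (1 : T)) - F x)) @ 0^' --> f x.
  apply/cvgrPdist_lt => e e0.
  have [d d0 dP] := dF x e e0.
  near=> h.
  have h0 : h != 0 by near: h; exact: nbhs_dnbhs_neq.
  have hd : `|h| < d by near: h; exact: dnbhs0_lt.
  have := dP h h0 hd; rewrite distrC /= /GRing.scale /= mulr1 (addrC h x).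
  by rewrite (mulrC h^-1).
split; first by apply/cvg_ex; exists (f x).
exact: (cvg_lim _ H).
Unshelve. all: by end_near.
Qed.

Lemma is_derive_derivative_eps (F f : T -> T) :
  (forall x : T, is_derive x (1 : T) F (f x)) -> derivative_eps F f.
Proof.
move=> dF x e e0; have dFx := dF x.
have /cvgrPdist_lt /(_ e e0) : (fun h : T => h^-1 *: ((F \o shift x) (h *: (1 : T)) - F x)) @ 0^' --> f x.
  by rewrite -(@derive_val _ _ _ _ _ _ _ dFx); exact: (@ex_derive _ _ _ _ _ _ _ dFx).
rewrite /dnbhs/= near_withinE near_simpl => -[d /= d0 dP]; exists d => // h h0 hd.
have /= := dP h; rewrite sub0r normrN => /(_ hd h0).
by rewrite distrC /GRing.scale /= mulr1 (addrC h x) (mulrC h^-1).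
Qed.

Lemma integral_derivative_eps (f F : T -> T) (a b : T) : a < b ->
  continuous_eps f -> derivative_eps F f ->
  (\int[@lebesgue_measure T]_(x in `[a, b]) (f x)%:E = (F b - F a)%:E)%E.
Proof.
move=> ab /continuous_eps_continuous cf dF.
have D x := derivative_eps_is_derive F f x dF.
have cF x : {for x, continuous F}.
  by apply: differentiable_continuous; apply/derivable1_diffP; exact: ex_derive.
rewrite (@continuous_FTC2 T f F a b ab).
- by rewrite EFinB.
- exact: continuous_subspaceT.
- split.
  + by move=> x _; exact: ex_derive.
  + by apply: cvg_at_right_filter; exact: cF.
  + by apply: cvg_at_left_filter; exact: cF.
- by move=> x _; rewrite derive1E; exact: derive_val.
Qed.

(** Rounding [x] down to a multiple of [1 / (n + 1)] gives a function measurable on each of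
    countably many strips, by continuity in [y]; continuity in [x] makes these functions converge
    pointwise to [k]. *)
Lemma measurable_separately_continuous (k : T * T -> T) :
  (forall x, continuous_eps (fun y => k (x, y))) ->
  (forall y, continuous_eps (fun x => k (x, y))) ->
  measurable_fun [set: T * T] k.
Proof.
move=> ck1 ck2.
pose c (n : nat) (x : T) : T := (Num.floor (x * n.+1%:R))%:~R / n.+1%:R.
apply: (@measurable_fun_cvg _ _ T _ (fun n z => k (c n z.1, z.2))) => [n|[x y] _].
- move=> _ Y mY; rewrite setTI.
  rewrite (_ : _ @^-1` _ = \bigcup_(m : int)
      ([set x : T | m%:~R <= x * n.+1%:R < (m + 1)%:~R] `*`
       ((fun y => k (m%:~R / n.+1%:R, y)) @^-1` Y))); last first.
    apply/seteqP; split => [[x y] /= kY|[x y] [m _] [/= xm kY]].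
      by exists (Num.floor (x * n.+1%:R)) => //; split => //=; exact: floor_itv.
    by rewrite /c; move: xm; rewrite -floor_eq => /eqP ->.
  apply: countable_bigcupT_measurable => // m; apply: measurableX.
    rewrite (_ : [set x | _] = [set` Interval (BLeft (m%:~R / n.+1%:R)) (BLeft ((m + 1)%:~R / n.+1%:R))]).
      exact: measurable_itv.
    by apply/seteqP; split => x /=; rewrite in_itv/= ler_pdivrMr ?ltr0n// ltr_pdivlMr ?ltr0n.
  rewrite -[X in measurable X]setTI.
  apply: (continuous_measurable_fun (continuous_eps_continuous _ (ck1 _))) => //.
- have ck := continuous_eps_continuous _ (ck2 y) x.
  apply: (@cvg_comp _ _ _ (c ^~ x) (fun x => k (x, y)) _ (nbhs x)); last exact: ck.
  apply/cvgrPdist_lt => e e0.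
  near=> n.
  have N0 : 0 < n.+1%:R :> T by rewrite ltr0n.
  have /andP[f1 f2] := floor_itv (x * n.+1%:R).
  rewrite ger0_norm /c; last by rewrite subr_ge0 ler_pdivrMr.
  rewrite ltrBlDr -ltrBlDl ltr_pdivlMr// mulrBl.
  have eN : 1 < e * n.+1%:R.
    rewrite -ltr_pdivrMl// mulr1; apply: lt_trans (_ : n%:R < n.+1%:R).
      by near: n; exact: nbhs_infty_gtr.
    by rewrite ltr_nat.
  move: f2; rewrite intrD mulr1z -ltrBlDr => f2.
  apply: le_lt_trans f2. by rewrite lerD2l lerN2 ltW.
Unshelve. all: by end_near.
Qed.

(** Tonelli's theorem, then restriction of both integrals of the nonnegative [k] to [[a, b]]. The
    iterated integral is given by primitives, so that the fundamental theorem of calculus turns each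
    into a Lebesgue integral. *)
Lemma iterated_integral_le (k : T * T -> T) (F : T -> T -> T) (G : T -> T) (a b : T) : a < b ->
  (forall x, continuous_eps (fun y => k (x, y))) ->
  (forall y, continuous_eps (fun x => k (x, y))) ->
  (forall z, 0 <= k z) ->
  (forall x, derivative_eps (F x) (fun y => k (x, y))) ->
  continuous_eps (fun x => F x b - F x a) ->
  derivative_eps G (fun x => F x b - F x a) ->
  ((G b - G a)%:E <= \int[(@lebesgue_measure T) \x (@lebesgue_measure T)]_z (k z)%:E)%E.
Proof.
move=> ab ck1 ck2 k0 dF cF dG.
have mk := measurable_separately_continuous k ck1 ck2.
have mkE : measurable_fun [set: T * T] (fun z => (k z)%:E) by exact/measurable_EFinP.
have k0E z : (0 <= (k z)%:E)%E by rewrite lee_fin.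
rewrite fubini_tonelli1//.
rewrite -(integral_derivative_eps (fun x => F x b - F x a) G a b ab cF dG).
pose Fk (x : T) := (\int[@lebesgue_measure T]_y (k (x, y))%:E)%E.
have mF : measurable_fun [set: T] Fk.
  exact: (@measurable_fun_fubini_tonelli_F _ _ _ _ T (@lebesgue_measure T) _ mkE k0E).
have F0 x : (0 <= Fk x)%E by apply: integral_ge0.
rewrite /fubini_F -/Fk.
have FE x : ((F x b - F x a)%:E = \int[lebesgue_measure]_(y in `[a, b]) (k (x, y))%:E)%E.
  by rewrite (integral_derivative_eps (fun y => k (x, y)) (F x)).
apply: (@le_trans _ _ (\int[lebesgue_measure]_(x in `[a, b]) Fk x)%E).
- apply: ge0_le_integral => //.
  + by move=> x _; rewrite FE; apply: integral_ge0.
  + apply/measurable_EFinP; apply: measurable_funTS.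
    by apply: continuous_measurable_fun; exact: continuous_eps_continuous.
  + exact: measurable_funTS.
  + move=> x _; rewrite FE.
    apply: ge0_subset_integral => //.
    exact: (@measurable_fun_pair2 _ _ _ _ _ _ (fun z => (k z)%:E) x mkE).
- by apply: ge0_subset_integral.
Qed.

Lemma derivative_eps_cos : derivative_eps (@trigo.cos T) (fun x => - trigo.sin x).
Proof. by apply: is_derive_derivative_eps => x; exact: trigo.is_derive_cos. Qed.

Lemma derivative_eps_sin : derivative_eps (@trigo.sin T) (@trigo.cos T).
Proof. by apply: is_derive_derivative_eps => x; exact: trigo.is_derive_sin. Qed.
End IteratedIntegral.

Lemma RInt_point_R (f : R -> R) (a : R) : RInt f a a = 0%R.
Proof. exact: RInt_point. Qed.

Lemma square_integral_le_area_integral (k : R * R -> R) (b : R) :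
  cont2 (fun x y => k (x, y)) -> (forall z, Rle 0 (k z)) -> Rlt 0 b ->
  ((square_integral (fun x y => k (x, y)) b)%:E <= area_integral k)%E.
Proof.
move=> ck k0 b0.
have toC (f : R -> R) : (forall x, Continuity.continuous (f : R_UniformSpace -> R_UniformSpace) x) ->
    continuous_eps R f.
  move=> cf x e /RltP/(continuous_eps_delta f cf x)[d [/RltP d0 dP]]; exists d => // y.
  by rewrite -RabsE => /RltP/dP/RltP; rewrite RabsE.
have toD (f : R -> R) (a : R) : (forall x, Continuity.continuous (f : R_UniformSpace -> R_UniformSpace) x) ->
    derivative_eps R (RInt f a) f.
  move=> cf x e /RltP/(RInt_derivative_eps_delta f a cf x)[d [/RltP d0 dP]]; exists d => // h h0.
  rewrite -RabsE => /RltP /(dP h (elimN eqP h0))/RltP.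
  by rewrite RabsE RminusE RdivE RminusE RplusE.
(* Starting the primitives at [- b] makes their values there vanish, so their increments are the
   Riemann integrals themselves. *)
pose F x y := RInt (fun y => k (x, y)) (- b)%R y.
pose inner x := (F x b - F x (- b))%R.
have innerE x : inner x = RInt (fun y => k (x, y)) (- b)%R b.
  by rewrite /inner /F RInt_point_R subr0.
have cinner x : Continuity.continuous (inner : R_UniformSpace -> R_UniformSpace) x.
  rewrite (_ : inner = fun x => RInt (fun y => k (x, y)) (- b)%R b); last exact/funext.
  exact: (RInt_param_continuous (fun x y => k (x, y))).
have H := @iterated_integral_le R k F (RInt inner (- b)%R) (- b)%R b.
rewrite RInt_point_R subr0 in H.
rewrite /square_integral.
rewrite (_ : (fun x => RInt (fun y => k (x, y)) (- b)%R b) = inner); last first.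
  by apply/funext => x; rewrite innerE.
apply: H.
- by rewrite gtrN //; exact/RltP.
- by move=> x; apply: toC => y; exact: (cont2_slice_r (fun x y => k (x, y))).
- by move=> y; apply: toC => x; exact: (cont2_slice_l (fun x y => k (x, y))).
- by move=> z; apply/RleP.
- by move=> x; apply: toD => y; exact: (cont2_slice_r (fun x y => k (x, y))).
- exact: toC.
- exact: toD.
Qed.

(* [Mp] is elaborated with the power-series cosine and sine of a general [realType], not with the
   trigonometric functions of the Reals library. *)
Lemma trigo_cos_sin (x : R) : trigo.cos x = Rtrigo_def.cos x /\ trigo.sin x = Rtrigo_def.sin x.
Proof.
have toD (f g : R -> R) : derivative_eps R f g -> forall x, derivable_pt_lim f x (g x).
  move=> H y e /RltP/(H y e)[d /RltP d0 dP]; exists (mkposreal d d0) => h /eqP h0.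
  move=> /RltP; rewrite RabsE => /(dP h h0) He; apply/RltP.
  by rewrite RabsE RminusE RdivE RminusE RplusE.
apply: (cos_sin_unique trigo.cos trigo.sin).
- exact: (toD _ _ (derivative_eps_cos R)).
- exact: (toD _ _ (derivative_eps_sin R)).
- exact: trigo.cos0.
- exact: trigo.sin0.
Qed.

Lemma rpow_Mp (p r : R) (f : C -> C) : Rlt 1 p -> entire f -> rpow (Mp p r f) p = mean_pow f p r.
Proof.
move=> p1 ef; rewrite -[RHS](rpow_rpow_inv _ p).
- congr (rpow (rpow _ _) _); rewrite /mean_pow; congr (RInt _ _ _).
  by apply/funext => t; have [-> ->] := trigo_cos_sin t.
- exact: (Rlt_trans _ _ _ Rlt_0_1 p1).
- apply: mean_pow_ge_0; last exact: entire_holomorphic.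
  exact: Rlt_le.
Qed.

(* From finiteness of [Dp_pow] to a uniform bound on square integrals *)
From Coquelicot Require Import Coquelicot.
Open Scope R_scope.

Theorem theorem4p3 (p : R) (w : R -> R) (f : C -> C) :
  1 < p ->
  analytic_near_nonneg w ->
  (forall x, 0 <= x -> 0 < w x) ->
  (forall x y, 0 <= x -> x <= y -> w y <= w x) ->
  (forall x, 0 <= x -> 0 < lam_of w x) ->
  (forall x y, 0 <= x -> x < y -> lam_of w x < lam_of w y) ->
  (forall (n : nat) x, 0 <= x -> ex_derive_n (lam_of w) n x) ->
  Rbar_lt 0 (liminf_pinfty (fun x => S_fun x (lam_of w))) ->
  (exists C0 : R, 0 < C0 /\ exists R0 : R, forall r, R0 <= r -> - Derive w r >= C0 * w r) ->
  entire f ->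
  (Dp_pow p f w < +oo)%E ->
  is_lim (fun r => r ^ 3 * rpow (Mp p r f) p * w (r ^ 2)) p_infty 0.
Proof.
move=> p1 _ w0 _ lam0 _ lamd HS HC ef Dfin.
have lam1 x : 0 <= x -> Derive.ex_derive (lam_of w) x by move=> x0; exact: (lamd 1%N x x0).
apply: (is_lim_ext (fun r => r ^ 3 * mean_pow f p r * w (r ^ 2))).
  by move=> r; rewrite rpow_Mp.
have k0 := density_ge_0 p f w lam0.
have ck := density_cont2 p f w p1 ef lam0 lam1.
have sq b : 0 < b -> ((square_integral (fun x y => density p f w (x, y)) b)%:E <= Dp_pow p f w)%E.
  by move=> b0; exact: (square_integral_le_area_integral (density p f w)).
(* [Dfin] excludes only [+oo]; the value [-oo] is excluded by the comparison with the square
   integral at [b = 1]. *)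
have Dfn : Dp_pow p f w \is a fin_num.
  rewrite fin_numElt Dfin andbT.
  by apply: lt_le_trans (sq 1 Rlt_0_1); exact: ltNyr.
apply: (weighted_mean_is_lim_0 p f w p1 ef lam0 lam1 (fine (Dp_pow p f w)) w0 HS HC) => b b2.
apply/RleP; rewrite -lee_fin fineK //; apply: sq.
exact: (Rlt_le_trans _ _ _ Rlt_0_2 b2).
Qed.
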